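(* Let $G$ be a graph with a perfect matching. Then $G$ is a Sterboul--Deming graph if and only if $G$ is a $1$-Sachs critical graph.
   Context: All graphs are finite, undirected and simple. A Sachs subgraph of a graph $H$ is a spanning subgraph of $H$ each of whose components is either $K_2$ or a cycle. A graph $G$ is $k$-Sachs critical if $G-S$ has at least one Sachs subgraph for every $S\subseteq V(G)$ with $|S|=k$. Let $M$ be a matching of a graph $G$. A path (or walk) is $M$-alternating if, of any two consecutive edges, exactly one belongs to $M$; an $mm$-$M$-path is an $M$-alternating path whose first and last edges are in $M$. An $M$-blossom is an odd cycle of length $2k+1$ with exactly $k$ edges in $M$; its base is the unique vertex of the cycle not covered by those $k$ edges. An $M$-Tflower consists of an $M$-blossom together with an $M$-stem, i.e. an $M$-alternating path of even length (possibly zero) connecting the base of the blossom to a vertex not saturated by $M$ in $G$, where the base is the only common vertex of the blossom and the stem. An $M$-Tposy consists of two $M$-blossoms joined by an $mm$-$M$-path whose endpoints are the bases of the two blossoms, such that no internal vertex of the path lies in the blossoms and the intersection of the two blossoms is either empty or an $mm$-$M$-path. Define $SD(G)$ as the set of vertices $v$ of $G$ for which there is a maximum matching $M$ of $G$ such that $v$ lies in an $M$-Tflower or an $M$-Tposy, and $KE(G)=V(G)\setminus SD(G)$. A graph $G$ is a Sterboul--Deming graph if $KE(G)=\emptyset$. *)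

(* Defs.v *)
From HB Require Import structures.
From mathcomp Require Import all_boot.

Set Implicit Arguments.
Unset Strict Implicit.
Unset Printing Implicit Defensive.

Record sgraph := SGraph {
  vertex :> finType;
  adj : rel vertex;
  adj_sym : symmetric adj;
  adj_irrefl : irreflexive adj
}.

Section Subgraphs.
Variable G : sgraph.
Implicit Types (c p : seq G) (x y : G).

Definition edges : {set {set G}} :=
  [set [set x; y] | x in [set: G], y in [set: G] & adj x y].

Definition walk_edges x p : seq {set G} :=
  pairmap (fun u v => [set u; v]) x p.

(* The path with vertex sequence x :: p, of length size p. *)
Definition is_path x p := path (@adj G) x p && uniq (x :: p).

Definition is_cycle c := [&& 2 < size c, uniq c & cycle (@adj G) c].

Definition cycle_edges c : {set {set G}} :=
  [set [set x; next c x] | x in c].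

(* A spanning subgraph is given by its edge set F. *)
Definition component (F : {set {set G}}) x : {set G} :=
  [set y | connect [rel u v | [set u; v] \in F] x y].

Definition component_edges (F : {set {set G}}) x : {set {set G}} :=
  [set f in F | f \subset component F x].

Definition K2_component (F : {set {set G}}) x : Prop :=
  exists u v, [/\ u != v, component F x = [set u; v]
                & component_edges F x = [set [set u; v]]].

Definition cycle_component (F : {set {set G}}) x : Prop :=
  exists c, [/\ is_cycle c, component F x = [set u in c]
              & component_edges F x = cycle_edges c].

Definition sachs_subgraph (F : {set {set G}}) : Prop :=
  F \subset edges /\ forall x, K2_component F x \/ cycle_component F x.

End Subgraphs.

Section VertexDeletion.
Variables (G : sgraph) (S : {set G}).

Definition del_vertex : finType := {x : G | x \notin S}.
Definition del_adj : rel del_vertex := [rel x y | adj (val x) (val y)].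

Lemma del_adj_sym : symmetric del_adj.
Proof. by move=> x y; apply: adj_sym. Qed.

Lemma del_adj_irrefl : irreflexive del_adj.
Proof. by move=> x; apply: adj_irrefl. Qed.

Definition del_vertices : sgraph := SGraph del_adj_sym del_adj_irrefl.

End VertexDeletion.

Definition sachs_critical (k : nat) (G : sgraph) : Prop :=
  forall S : {set G}, #|S| = k ->
    exists F : {set {set del_vertices S}}, sachs_subgraph F.

Section SterboulDeming.
Variable G : sgraph.
Implicit Types (M : {set {set G}}) (c p : seq G) (x y v b : G).

Definition matching M := (M \subset edges G) && trivIset M.

Definition saturated M v := v \in cover M.

Definition perfect_matching M :=
  matching M && [forall v, saturated M v].

Definition maximum_matching M : Prop :=
  matching M /\ forall M', matching M' -> #|M'| <= #|M|.

Definition alternating_path M x p :=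
  is_path x p
  && sorted (fun f g => (f \in M) (+) (g \in M)) (walk_edges x p).

Definition mm_path M x p :=
  alternating_path M x p
  && (if walk_edges x p is f :: s then (f \in M) && (last f s \in M)
      else false).

Definition blossom M c b :=
  [&& is_cycle c, odd (size c), #|cycle_edges c :&: M| == (size c)./2,
      b \in c & b \notin cover (cycle_edges c :&: M)].

(* The blossom c has base x, and x :: p is the stem. *)
Definition tflower M c x p : Prop :=
  [/\ blossom M c x,
      alternating_path M x p,
      ~~ odd (size p),
      ~~ saturated M (last x p)
    & [set z in c] :&: [set z in x :: p] = [set x]].

Definition is_mm_path_subgraph M (V : {set G}) (F : {set {set G}}) : Prop :=
  exists y q, [/\ mm_path M y q, V = [set z in y :: q]
                & F = [set f in walk_edges y q]].

(* The intersection of the two blossoms is taken as an intersection of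
   subgraphs, on both vertices and edges. *)
Definition tposy M c1 c2 x p : Prop :=
  [/\ blossom M c1 x /\ blossom M c2 (last x p),
      mm_path M x p,
      forall z, z \in x :: p -> z != x -> z != last x p ->
        z \notin c1 /\ z \notin c2
    & [set z in c1] :&: [set z in c2] = set0 \/
      is_mm_path_subgraph M ([set z in c1] :&: [set z in c2])
                            (cycle_edges c1 :&: cycle_edges c2)].

Definition in_tflower M v : Prop :=
  exists c x p, tflower M c x p /\ (v \in c \/ v \in x :: p).

Definition in_tposy M v : Prop :=
  exists c1 c2 x p, tposy M c1 c2 x p /\
    [\/ v \in c1, v \in c2 | v \in x :: p].

Definition SD v : Prop :=
  exists M, maximum_matching M /\ (in_tflower M v \/ in_tposy M v).

Definition KE v : Prop := ~ SD v.

End SterboulDeming.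

Definition sterboul_deming (G : sgraph) : Prop := forall v : G, ~ KE v.

(* Main.v *)
Require Import Defs.
From mathcomp Require Import fingroup perm all_boot zify.

(** Let mu be a perfect matching, viewed as an involution.  G - v has a Sachs
    subgraph iff some permutation fixes v and moves every other vertex to a
    neighbour; composing it with mu shows that this holds iff the digraph
    a -> b := adj (mu a) b has a path from v to mu v, i.e. iff there is an
    alternating closed walk at v beginning and ending with v - mu v.  Around a
    Tposy all states of this digraph are strongly connected, which gives one
    implication.

    For the converse, one has to find through v two disjoint odd cycles joined
    by an odd path, or a subdivision of K4 with all six paths odd, whose
    complement is perfectly matchable: choosing the matching suitably, these
    are exactly the Tposies.  Call flower an alternating stem ending in an odd
    cycle.  Start from the edge v - mu v, seen as a degenerate even cycle, and
    a flower attached to it, and descend on the size of the attached piece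
    (the hook) among three kinds of configurations with matchable complement:
    an even cycle through v with a flower attached; an even cycle through v
    with an odd ear joining two vertices of the same colour class; three odd
    paths joining s and t, one of them through v, with an odd ear between
    inner vertices of the other two that have the colour of t.  Connectedness
    of the digraph provides a flower or an odd ear at the opposite colour
    class.  If it avoids the hook, the required subgraph appears; otherwise
    its first meeting with the hook yields such a subgraph, or a configuration
    with a smaller hook. *)

Set Implicit Arguments.
Unset Strict Implicit.
Unset Printing Implicit Defensive.

(** * Alternate entries, links and matchable lists *)

(** On the inner vertices of a path, [evens] and [odds] are the two colour classes; [evens] is the
    one opposite to the starting point. *)
Fixpoint evens (T : Type) (l : seq T) : seq T :=
  if l is x :: l' then x :: (if l' is _ :: l'' then evens l'' else [::]) else [::].

Definition odds (T : Type) (l : seq T) : seq T := evens (behead l).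

Section Parity.
Variable T : eqType.
Implicit Types (l : seq T) (x y : T).

Lemma evens_cons x l : evens (x :: l) = x :: odds l.
Proof. by case: l. Qed.

Lemma odds_cons x l : odds (x :: l) = evens l.
Proof. by []. Qed.

Lemma parity_cat l1 l2 :
  evens (l1 ++ l2) = evens l1 ++ (if odd (size l1) then odds l2 else evens l2) /\
  odds (l1 ++ l2) = odds l1 ++ (if odd (size l1) then evens l2 else odds l2).
Proof.
elim: l1 => // x l [IHe IHo].
by rewrite cat_cons !evens_cons !odds_cons IHe IHo oddS; case: (odd _).
Qed.

Lemma evens_cat l1 l2 : ~~ odd (size l1) -> evens (l1 ++ l2) = evens l1 ++ evens l2.
Proof. by move=> /negPf o; have [-> _] := parity_cat l1 l2; rewrite o. Qed.

Lemma odds_cat l1 l2 : ~~ odd (size l1) -> odds (l1 ++ l2) = odds l1 ++ odds l2.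
Proof. by move=> /negPf o; have [_ ->] := parity_cat l1 l2; rewrite o. Qed.

Lemma evens_rev l : evens (rev l) = rev (if odd (size l) then evens l else odds l).
Proof.
elim: l => // x l IH; have [e _] := parity_cat (rev l) [:: x].
rewrite rev_cons -cats1 e IH size_rev !evens_cons !odds_cons oddS.
by case: (odd _); [rewrite cats0 | rewrite rev_cons -cats1].
Qed.

Lemma mem_parity x l :
  (x \in evens l -> exists l1 l2, l = l1 ++ x :: l2 /\ ~~ odd (size l1)) /\
  (x \in odds l -> exists l1 l2, l = l1 ++ x :: l2 /\ odd (size l1)).
Proof.
elim: l => [|y l [IHe IHo]]; first by [].
rewrite evens_cons odds_cons inE; split.
  case/orP=> [/eqP->|/IHo [l1 [l2 [-> o1]]]]; first by exists [::], l.
  by exists (y :: l1), l2; rewrite /= negbK.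
by move=> /IHe [l1 [l2 [-> e1]]]; exists (y :: l1), l2.
Qed.

Lemma evens_split x l : x \in evens l ->
  exists l1 l2, l = l1 ++ x :: l2 /\ ~~ odd (size l1).
Proof. by case: (mem_parity x l). Qed.

Lemma odds_split x l : x \in odds l ->
  exists l1 l2, l = l1 ++ x :: l2 /\ odd (size l1).
Proof. by case: (mem_parity x l). Qed.

Lemma count_parity (a : pred T) l : count a l = count a (evens l) + count a (odds l).
Proof. by elim: l => // x l IH; rewrite evens_cons odds_cons /= IH; lia. Qed.

End Parity.

Ltac par :=
  repeat match goal with
  | H : is_true (odd _) |- _ => move: H
  | H : is_true (~~ odd _) |- _ => move: H
  | H : _ = _ :> nat |- _ => move: H
  end; clear;
  rewrite ?(size_cat, size_rev, size_rcons) /= ?(size_cat, size_rev, size_rcons) /=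
    ?(size_cat, size_rev, size_rcons) /=; lia.

Ltac mems :=
  repeat match goal with
  | H : is_true (in_mem _ _) |- _ => move: H
  | H : is_true (~~ in_mem _ _) |- _ => move: H
  end; clear;
  rewrite ?(inE, mem_cat, mem_rev) /=;
  repeat match goal with
  | |- context [in_mem ?x ?l] => case: (in_mem x l) => //=
  | |- context [@eq_op ?T ?x ?l] => case: (@eq_op T x l) => //=
  end.

(** Proves that rearranged pieces still partition the vertices, by linear arithmetic on
    multiplicities; [count_parity] links a list to its two alternate halves. *)
Ltac cov H :=
  let y := fresh "y" in
  move=> y; rewrite -(H y); clear;
  rewrite -?cats1 /= ?(count_cat, count_rev) /= ?(count_cat, count_rev) /=
    ?(count_cat, count_rev) /= ?(count_cat, count_rev) /=;
  repeat match goal with |- context [count ?a (evens ?d)] =>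
    move: (count_parity a d); move: (count a (evens d)) => ? end;
  repeat match goal with |- context [nat_of_bool ?b] => move: (nat_of_bool b) => ? end;
  repeat match goal with |- context [count ?a ?b] => move: (count a b) => ? end;
  lia.

Section Configurations.
Variable G : sgraph.
Implicit Types (x y s t u w z v : G) (l q c d h r : seq G).

(* [l] lists the inner vertices: the path has odd length iff [l] has even size. *)
Definition link u l w := path (@adj G) u (rcons l w).

Lemma link_rev u l w : link u l w -> link w (rev l) u.
Proof.
rewrite /link -[path _ u _]rev_path last_rcons belast_rcons rev_cons => pl.
by rewrite (eq_path (e' := fun x y => adj y x)) // => x y; rewrite adj_sym.
Qed.

Lemma link_cat u l w l' z : link u l w -> link w l' z -> link u (l ++ w :: l') z.
Proof.
by rewrite /link rcons_cat rcons_cons -cat_rcons cat_path last_rcons => -> ->.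
Qed.

Lemma link_split u l w l' z :
  link u (l ++ w :: l') z -> link u l w /\ link w l' z.
Proof.
by rewrite /link rcons_cat rcons_cons -cat_rcons cat_path last_rcons => /andP.
Qed.

Lemma link_nil u w : adj u w -> link u [::] w.
Proof. by rewrite /link /= andbT. Qed.

Lemma link_path u l w q : link u l w -> path (@adj G) w q -> path (@adj G) u (l ++ w :: q).
Proof. by rewrite -cat_rcons cat_path last_rcons /link => ->. Qed.

Definition matchable r := exists ps : seq (G * G),
  all (fun p => adj p.1 p.2) ps /\ perm_eq r (unzip1 ps ++ unzip2 ps).

(** Keeps the two sides apart, so that the walk of [escapes] can tell which colour class it
    enters. *)
Definition bimatch b0 b1 := exists ps : seq (G * G),
  [/\ all (fun p => adj p.1 p.2) ps, perm_eq b0 (unzip1 ps) & perm_eq b1 (unzip2 ps)].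

Lemma matchable0 : matchable [::].
Proof. by exists [::]. Qed.

Lemma matchable_cat r1 r2 : matchable r1 -> matchable r2 -> matchable (r1 ++ r2).
Proof.
move=> [p1 [a1 e1]] [p2 [a2 e2]]; exists (p1 ++ p2); rewrite all_cat a1 a2; split=> //.
apply/permP=> a; have /permP/(_ a) := e1; have /permP/(_ a) := e2.
by rewrite /unzip1 /unzip2 !map_cat !count_cat; lia.
Qed.

Lemma bimatch_cat a0 a1 b0 b1 :
  bimatch a0 a1 -> bimatch b0 b1 -> bimatch (a0 ++ b0) (a1 ++ b1).
Proof.
move=> [p1 [k1 e1 f1]] [p2 [k2 e2 f2]]; exists (p1 ++ p2).
by rewrite all_cat k1 k2 /unzip1 /unzip2 !map_cat !perm_cat.
Qed.

Lemma bimatch_sym b0 b1 : bimatch b0 b1 -> bimatch b1 b0.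
Proof.
move=> [ps [k e0 e1]]; exists [seq (p.2, p.1) | p <- ps]; split.
- by rewrite all_map; apply: sub_all k => p /=; rewrite adj_sym.
- by rewrite /unzip1 -map_comp.
- by rewrite /unzip2 -map_comp.
Qed.

Lemma bimatch_path l x : path (@adj G) x l -> odd (size l) ->
  bimatch (x :: odds l) (evens l).
Proof.
have [n] := ubnP (size l); elim: n l x => // n IH [|y [|z l]] //= x ltn.
  by rewrite andbT => xy _; exists [:: (x, y)]; rewrite /= xy.
case/and3P=> xy yz pl; rewrite negbK => ol; rewrite odds_cons evens_cons.
have [|ps [k e0 e1]] := IH _ _ _ pl ol; first by lia.
by exists ((x, y) :: ps); rewrite /= xy !perm_cons.
Qed.

Lemma bimatch_link u l w : link u l w -> ~~ odd (size l) ->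
  bimatch (evens l) (odds l).
Proof.
case: l => [|x l] lk el; first by exists [::].
rewrite evens_cons odds_cons; apply: bimatch_path => //; last by move: el => /=; lia.
by move: lk; rewrite /link /= rcons_path => /and3P[].
Qed.

(** With an odd number of inner vertices one endpoint has to be matched along: the first here, the
    last in [bimatch_linkr]. *)
Lemma bimatch_linkl u l w : link u l w -> odd (size l) ->
  bimatch (u :: odds l) (evens l).
Proof. by rewrite /link rcons_path => /andP[pl _]; apply: bimatch_path. Qed.

Lemma bimatch_linkr u l w : link u l w -> odd (size l) ->
  bimatch (evens l) (rcons (odds l) w).
Proof.
case: l => [|x l] // lk; rewrite evens_cons odds_cons [odd _]/= => el.
have := @bimatch_path (rcons l w) x; rewrite size_rcons => /(_ _ el).
rewrite -!cats1 evens_cat // odds_cat // cats0; apply.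
by move: lk; rewrite /link /= cats1 => /andP[].
Qed.

Lemma bimatch_matchable b0 b1 l : bimatch b0 b1 ->
  (forall a, count a l = count a b0 + count a b1) -> matchable l.
Proof.
move=> [ps [k e0 e1]] e; exists ps; split=> //; apply/permP=> a.
by rewrite e count_cat (permP e0) (permP e1).
Qed.

Lemma matchable_link u l w : link u l w -> ~~ odd (size l) -> matchable l.
Proof.
by move=> lk el; apply: (bimatch_matchable (bimatch_link lk el)) => a; apply: count_parity.
Qed.

Lemma matchable_path u q : path (@adj G) u q -> ~~ odd (size q) -> matchable q.
Proof.
case/lastP: q => [|q w]; first by move=> _ _; apply: matchable0.
rewrite size_rcons /= negbK => lk oq.
have := bimatch_linkl lk oq; case: q lk oq => // x q; rewrite /link /= => /andP[_ lk] oq _.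
apply: (bimatch_matchable (bimatch_path (x := x) (l := rcons q w) lk _)) => [|a].
  by rewrite size_rcons.
by have := count_parity a (x :: rcons q w); rewrite evens_cons odds_cons.
Qed.

(* Stated with multiplicities so that regrouping the pieces of a partition of
   the vertices is linear arithmetic. *)
Definition covers l := forall x, count_mem x l = 1.

Lemma covers_perm l r r' : covers (l ++ r) -> perm_eq r r' -> covers (l ++ r').
Proof. by move=> C e y; rewrite -(C y) !count_cat (permP e). Qed.

(** [q] omits the start [t], and [c] omits the base [last t q]: the stem has even length and the
    cycle odd length. *)
Definition flower t q c :=
  [/\ path (@adj G) t q, ~~ odd (size q), link (last t q) c (last t q) & ~~ odd (size c)].

Lemma flower0 t c : link t c t -> ~~ odd (size c) -> flower t [::] c.
Proof. by []. Qed.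

(* The list [r] holds the matched vertices outside the subgraph. *)
Definition barbell v := exists t s q1 c1 q2 c2 l r,
  [/\ flower t q1 c1, flower s q2 c2, link t l s & ~~ odd (size l)] /\
  [/\ matchable r, covers (t :: s :: q1 ++ c1 ++ q2 ++ c2 ++ l ++ r)
    & v \in t :: s :: q1 ++ c1 ++ q2 ++ c2 ++ l].

Definition odd_K4 v := exists (a b c d : G) (ab cd ac da bc db r : seq G),
  [/\ link a ab b, link c cd d, link a ac c, link d da a & link b bc c /\ link d db b] /\
  [/\ ~~ odd (size ab), ~~ odd (size cd), ~~ odd (size ac), ~~ odd (size da)
    & ~~ odd (size bc) /\ ~~ odd (size db)] /\
  [/\ matchable r, covers (a :: b :: c :: d :: ab ++ cd ++ ac ++ da ++ bc ++ db ++ r)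
    & v \in a :: b :: c :: d :: ab ++ cd ++ ac ++ da ++ bc ++ db].

Definition good v := barbell v \/ odd_K4 v.

Lemma mk_barbell v t s q1 c1 q2 c2 l r :
  flower t q1 c1 -> flower s q2 c2 -> link t l s -> ~~ odd (size l) -> matchable r ->
  covers (t :: s :: q1 ++ c1 ++ q2 ++ c2 ++ l ++ r) ->
  v \in t :: s :: q1 ++ c1 ++ q2 ++ c2 ++ l -> good v.
Proof. by move=> *; left; exists t, s, q1, c1, q2, c2, l, r. Qed.

Lemma mk_K4 v (a b c d : G) (ab cd ac da bc db r : seq G) :
  link a ab b -> link c cd d -> link a ac c -> link d da a -> link b bc c -> link d db b ->
  ~~ odd (size ab) -> ~~ odd (size cd) -> ~~ odd (size ac) -> ~~ odd (size da) ->
  ~~ odd (size bc) -> ~~ odd (size db) -> matchable r ->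
  covers (a :: b :: c :: d :: ab ++ cd ++ ac ++ da ++ bc ++ db ++ r) ->
  v \in a :: b :: c :: d :: ab ++ cd ++ ac ++ da ++ bc ++ db -> good v.
Proof. by move=> *; right; exists a, b, c, d, ab, cd, ac, da, bc, db, r. Qed.

End Configurations.

Ltac lk := repeat first
  [ eassumption
  | match goal with
    | |- is_true (link _ (rev _) _) => apply: link_rev
    | |- is_true (link _ (_ ++ _ :: _) _) => apply: link_cat
    end ].

Ltac mat := repeat first
  [ eassumption | apply: matchable0 | apply: matchable_cat
  | match goal with H : is_true (link _ ?l _) |- matchable ?l =>
      apply: (matchable_link H); par end ].

Ltac pieces := try (by lk); try (by par); try (by mat).

(** * Even cycles carrying ears and flowers *)

Section Cases.
Variable G : sgraph.
Implicit Types (x y s t u w z v : G) (l q c d h r : seq G).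

(** The ear [h] and the arc [e2] close an odd cycle, joined to the flower by [e1] or by [e3]. The
    choice is made so that [v] is kept; the other arc has an even number of inner vertices and joins
    the matched rest. *)
Lemma flower_ear v t q c e1 s e2 s' e3 h r :
  flower t q c -> link t e1 s -> link s e2 s' -> link s' e3 t -> link s h s' ->
  ~~ odd (size e1) -> odd (size e2) -> ~~ odd (size e3) -> ~~ odd (size h) ->
  matchable r -> covers (t :: s :: s' :: q ++ c ++ e1 ++ e2 ++ e3 ++ h ++ r) ->
  v \in t :: s :: s' :: e1 ++ e2 ++ e3 -> good v.
Proof.
move=> F l1 l2 l3 lh o1 o2 o3 oh mr C vin.
have [v3|v3] := boolP (v \in e3).
  apply: (mk_barbell (t := t) (s := s') (q1 := q) (c1 := c) (q2 := [::])
    (c2 := rev e2 ++ s :: h) (l := rev e3) (r := e1 ++ r)) => //; pieces.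
  - by apply: flower0; [lk | par].
  - by cov C.
  - by mems.
apply: (mk_barbell (t := t) (s := s) (q1 := q) (c1 := c) (q2 := [::])
    (c2 := e2 ++ s' :: rev h) (l := e1) (r := e3 ++ r)) => //; pieces.
- by apply: flower0; [lk | par].
- by cov C.
- by mems.
Qed.

End Cases.

Section Cases.
Variable G : sgraph.
Implicit Types (x y s t u w z v : G) (l q c d h r : seq G).

(** Seen from [y], this is [flower_ear]: the arc [d2] and the ear [h] form the odd cycle, and the
    two parts of [d1] lead to it. *)
Lemma cycle_ear_flower1 v t1 t2 d1 d2 h y q c r :
  link t1 d1 t2 -> link t1 d2 t2 -> link t1 h t2 ->
  odd (size d1) -> odd (size d2) -> ~~ odd (size h) ->
  y \in evens d1 -> flower y q c -> matchable r ->
  covers (t1 :: t2 :: d1 ++ d2 ++ h ++ q ++ c ++ r) ->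
  v \in t1 :: t2 :: d1 ++ d2 -> good v.
Proof.
move=> l1 l2 lh o1 o2 oh /evens_split [e1 [e2 [? oe1]]] F mr C vin; subst d1.
have [l11 l12] := link_split l1.
apply: (flower_ear (t := y) (q := q) (c := c) (e1 := rev e1) (s := t1) (e2 := d2) (s' := t2)
  (e3 := rev e2) (h := h) (r := r)) => //; pieces.
- by cov C.
- by mems.
Qed.

Lemma cycle_ear_flower v t1 t2 d1 d2 h y q c r :
  link t1 d1 t2 -> link t1 d2 t2 -> link t1 h t2 ->
  odd (size d1) -> odd (size d2) -> ~~ odd (size h) ->
  y \in evens d1 ++ evens d2 -> flower y q c -> matchable r ->
  covers (t1 :: t2 :: d1 ++ d2 ++ h ++ q ++ c ++ r) ->
  v \in t1 :: t2 :: d1 ++ d2 -> good v.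
Proof.
move=> l1 l2 lh o1 o2 oh; rewrite mem_cat => /orP[yd|yd] F mr C vin.
  exact: (cycle_ear_flower1 l1 l2 lh o1 o2 oh yd F mr C vin).
apply: (cycle_ear_flower1 l2 l1 lh o2 o1 oh yd F mr).
- by cov C.
- by mems.
Qed.

(** The odd cycles [f2], [q] and [d], [h] are disjoint; [f1] or [f3] joins them, whichever keeps
    [v]. *)
Lemma noncrossing_ears v t1 f1 s f2 s' f3 t2 d h q r :
  link t1 f1 s -> link s f2 s' -> link s' f3 t2 -> link t1 d t2 -> link t1 h t2 ->
  link s q s' -> ~~ odd (size f1) -> odd (size f2) -> ~~ odd (size f3) ->
  odd (size d) -> ~~ odd (size h) -> ~~ odd (size q) -> matchable r ->
  covers (t1 :: t2 :: s :: s' :: f1 ++ f2 ++ f3 ++ d ++ h ++ q ++ r) ->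
  v \in t1 :: t2 :: s :: s' :: f1 ++ f2 ++ f3 ++ d -> good v.
Proof.
move=> l1 l2 l3 ld lh lq o1 o2 o3 od oh oq mr C vin.
have [v3|v3] := boolP (v \in f3).
  apply: (mk_barbell (t := s') (s := t2) (q1 := [::]) (c1 := rev f2 ++ s :: q) (q2 := [::])
    (c2 := rev d ++ t1 :: h) (l := f3) (r := f1 ++ r)) => //; pieces.
  - by apply: flower0; [lk | par].
  - by apply: flower0; [lk | par].
  - by cov C.
  - by mems.
apply: (mk_barbell (t := s) (s := t1) (q1 := [::]) (c1 := f2 ++ s' :: rev q) (q2 := [::])
    (c2 := d ++ t2 :: rev h) (l := rev f1) (r := f3 ++ r)) => //; pieces.
- by apply: flower0; [lk | par].
- by apply: flower0; [lk | par].
- by cov C.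
- by mems.
Qed.

(** If both ends of [q] lie on [d1], the ears do not cross and give a barbell. If they lie on
    different arcs, the ears cross and give an odd K4 on [t1], [s], [t2], [s']. *)
Lemma cycle_ear_ear1 v t1 t2 d1 d2 h s s' q r :
  link t1 d1 t2 -> link t1 d2 t2 -> link t1 h t2 ->
  odd (size d1) -> odd (size d2) -> ~~ odd (size h) ->
  s \in evens d1 -> s' \in evens d1 ++ evens d2 -> s' != s ->
  link s q s' -> ~~ odd (size q) -> matchable r ->
  covers (t1 :: t2 :: d1 ++ d2 ++ h ++ q ++ r) ->
  v \in t1 :: t2 :: d1 ++ d2 -> good v.
Proof.
move=> l1 l2 lh o1 o2 oh /evens_split [e1 [e2 [? oe1]]]; subst d1.
have [l11 l12] := link_split l1.
rewrite evens_cat // evens_cons -catA mem_cat cat_cons inE mem_cat.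
case/or4P=> [s'1 _|->//|s'1 _|s'2 _] lq oq mr C vin.
- have [f1 [f2 [? of1]]] := evens_split s'1; subst e1.
  have [k1 k2] := link_split l11.
  apply: (noncrossing_ears (v := v) (t1 := t1) (f1 := f1) (s := s') (f2 := f2) (s' := s)
    (f3 := e2) (t2 := t2) (d := d2) (h := h) (q := rev q) (r := r)) => //;
    pieces.
  + by cov C.
  + by mems.
- have [f1 [f2 [? of1]]] := odds_split s'1; subst e2.
  have [k1 k2] := link_split l12.
  apply: (noncrossing_ears (v := v) (t1 := t1) (f1 := e1) (s := s) (f2 := f1) (s' := s')
    (f3 := f2) (t2 := t2) (d := d2) (h := h) (q := q) (r := r)) => //;
    pieces.
  + by cov C.
  + by mems.
have [f1 [f2 [? of1]]] := evens_split s'2; subst d2.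
have [k1 k2] := link_split l2.
apply: (mk_K4 (v := v) (a := t1) (b := s) (c := t2) (d := s') (ab := e1) (cd := rev f2)
  (ac := h) (da := rev f1) (bc := e2) (db := rev q) (r := r)) => //; pieces.
- by cov C.
- by mems.
Qed.

Lemma cycle_ear_ear v t1 t2 d1 d2 h s s' q r :
  link t1 d1 t2 -> link t1 d2 t2 -> link t1 h t2 ->
  odd (size d1) -> odd (size d2) -> ~~ odd (size h) ->
  s \in evens d1 ++ evens d2 -> s' \in evens d1 ++ evens d2 -> s' != s ->
  link s q s' -> ~~ odd (size q) -> matchable r ->
  covers (t1 :: t2 :: d1 ++ d2 ++ h ++ q ++ r) ->
  v \in t1 :: t2 :: d1 ++ d2 -> good v.
Proof.
move=> l1 l2 lh o1 o2 oh; rewrite mem_cat => /orP[sd|sd] s'd ss lq oq mr C vin.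
  exact: (cycle_ear_ear1 l1 l2 lh o1 o2 oh sd s'd ss lq oq mr C vin).
apply: (cycle_ear_ear1 l2 l1 lh o2 o1 oh sd _ ss lq oq mr).
- by mems.
- by cov C.
- by mems.
Qed.

(* [b0] and [b1] are the colour classes of a bipartite part of the graph, [h] is
   a hook and [r] the rest: an alternating walk leaves [b0] through [r] until it
   first returns to [b0], meets [h], or closes on itself. *)
Definition escapes := forall b0 b1 h r,
  bimatch b0 b1 -> matchable h -> matchable r -> covers (b0 ++ b1 ++ h ++ r) ->
  b0 != [::] ->
  [\/ exists s q c r', [/\ s \in b0, flower s q c, matchable r' & perm_eq r (q ++ c ++ r')],
      exists s s' q r', [/\ s \in b0, s' \in b0, s' != s, link s q s' & ~~ odd (size q)] /\
         matchable r' /\ perm_eq r (q ++ r')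
    | exists s z q r', [/\ s \in b0, z \in h, link s q z & ~~ odd (size q)] /\
         matchable r' /\ perm_eq r (q ++ r')].

End Cases.

(** * Descent on the hook *)

Section Cases.
Variables (G : sgraph) (v : G).
Implicit Types (x y s t u w z : G) (l q c d h r : seq G).

(* [n] is the size of the hook, [v] the vertex to be covered. *)
Definition flower_case n := forall t d q c r,
  link t d t -> odd (size d) -> flower t q c -> matchable r ->
  covers (t :: d ++ q ++ c ++ r) -> v \in t :: d -> size q + size c = n -> good v.

(** Both arcs have odd inner size, so [t1] and [t2] share a colour class and the hook [h] closes an
    odd cycle with either arc. *)
Definition ear_case n := forall t1 t2 d1 d2 h r,
  link t1 d1 t2 -> link t1 d2 t2 -> link t1 h t2 ->
  odd (size d1) -> odd (size d2) -> ~~ odd (size h) -> matchable r ->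
  covers (t1 :: t2 :: d1 ++ d2 ++ h ++ r) ->
  v \in t1 :: t2 :: d1 ++ d2 -> size h = n -> good v.

(** The three odd paths are [a], [x], [b], then [e], [z], [f], then [g]; the parities give [x] and
    [z] the colour of [t]. The hook is [h], and [v] lies on the third path. *)
Definition theta_case n := forall s t x z a b e f g h r,
  link s a x -> link x b t -> link s e z -> link z f t -> link s g t -> link x h z ->
  ~~ odd (size a) -> odd (size b) -> ~~ odd (size e) -> odd (size f) ->
  ~~ odd (size g) -> ~~ odd (size h) -> matchable r ->
  covers (s :: t :: x :: z :: a ++ b ++ e ++ f ++ g ++ h ++ r) ->
  v \in s :: t :: g -> size h = n -> good v.

(** Either arc between [t] and [s] makes a barbell of the two flowers; the one kept contains [v]. *)
Lemma flower_flower t s d1 d2 q c q' c' r :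
  link t d1 s -> link s d2 t -> ~~ odd (size d1) -> ~~ odd (size d2) ->
  flower t q c -> flower s q' c' -> matchable r ->
  covers (t :: s :: d1 ++ d2 ++ q ++ c ++ q' ++ c' ++ r) ->
  v \in t :: s :: d1 ++ d2 -> good v.
Proof.
move=> l1 l2 o1 o2 F F' mr C vin.
have [v2|v2] := boolP (v \in d2).
  apply: (mk_barbell (t := t) (s := s) (q1 := q) (c1 := c) (q2 := q')
    (c2 := c') (l := rev d2) (r := d1 ++ r)) => //; pieces.
  - by cov C.
  - by mems.
apply: (mk_barbell (t := t) (s := s) (q1 := q) (c1 := c) (q2 := q')
    (c2 := c') (l := d1) (r := d2 ++ r)) => //; pieces.
- by cov C.
- by mems.
Qed.

(** The arc [d1] followed by [q'] reaches the hook, and [d2] is discarded into the matched rest.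
    Where and with which parity the hook is hit decides between a barbell and a smaller hook. *)
Lemma flower_hit n t s d1 d2 q c q' z r :
  (forall m, m < n -> flower_case m /\ ear_case m) ->
  link t d1 s -> link s d2 t -> ~~ odd (size d1) -> ~~ odd (size d2) ->
  flower t q c -> link s q' z -> ~~ odd (size q') -> z \in q ++ c -> matchable r ->
  covers (t :: s :: d1 ++ d2 ++ q ++ c ++ q' ++ r) ->
  v \in t :: s :: d1 -> size q + size c = n -> good v.
Proof.
move=> IH l1 l2 o1 o2 [pq oq lc oc] lq oq'; rewrite mem_cat => /orP[]; last first.
- move=> zc mr C vin en.
  (* As [size c] is even, [z] splits [c] into an odd and an even part; reversal makes the second one
     even, and it becomes the ear. *)
  wlog [c1 [c2 [ec oc1 oc2]]] : c lc oc zc C en /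
      exists c1 c2, [/\ c = c1 ++ z :: c2, odd (size c1) & ~~ odd (size c2)].
    move=> W; case/splitPr: zc lc oc C en => c1 c2 lc oc C en.
    have [oc1|oc1] := boolP (odd (size c1)).
      apply: (W (c1 ++ z :: c2)) => //; rewrite ?(mem_cat, inE, eqxx, orbT) //.
      by exists c1, c2; split=> //; par.
    apply: (W (rev (c1 ++ z :: c2))).
    + exact: link_rev.
    + by rewrite size_rev.
    + by rewrite mem_rev mem_cat inE eqxx orbT.
    + by cov C.
    + by rewrite size_rev.
    + exists (rev c2), (rev c1); rewrite !size_rev rev_cat rev_cons cat_rcons; split=> //.
      by par.
  subst c; have [lc1 lc2] := link_split lc.
  have [|_ E] := IH (size c2); first by par.
  (* The base of the odd cycle is [t] if the stem is empty and the end [x] of the stem otherwise. *)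
  case/lastP: q => [|q0 x] in pq oq lc lc1 lc2 C en *.
    apply: (E t z c1 (d1 ++ s :: q') (rev c2) (d2 ++ r)); rewrite ?size_rev //; pieces.
    + by cov C.
    + by mems.
  rewrite last_rcons in lc lc1 lc2; move: pq; rewrite -[path _ _ _]/(link t q0 x) => pq.
  apply: (E x z c1 (rev q0 ++ t :: d1 ++ s :: q') (rev c2) (d2 ++ r)); rewrite ?size_rev //; pieces.
  + by cov C.
  + by mems.
move=> zq mr C vin en.
case/splitPr: zq pq oq lc C en => q1 q2; rewrite -cat_rcons cat_path last_rcons last_cat last_rcons.
rewrite cat_rcons => /andP[pq1 pq2] oq lc C en.
rewrite -[path _ _ (rcons _ _)]/(link t q1 z) in pq1.
(* At even distance from [t] along the stem, [z] lies on a new even cycle through [v], and the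
   remainder of the flower hangs at [z]. *)
have [oq1|oq1] := boolP (odd (size q1)).
  have [|F _] := IH (size q2 + size c); first by par.
  apply: (F z (rev q1 ++ t :: d1 ++ s :: q') q2 c (d2 ++ r)) => //; pieces.
  - by split=> //; par.
  - by cov C.
  - by mems.
(* At odd distance, the new cycle through [z] is odd and the next stem vertex [y] carries a flower:
   the edge between them yields a barbell. Evenness of [size q] guarantees [y]. *)
case: q2 => [|y q2] in pq2 oq lc C en *; first by exfalso; par.
case/andP: pq2 => zy pq2.
apply: (mk_barbell (t := z) (s := y) (q1 := [::]) (c1 := rev q' ++ s :: rev d1 ++ t :: q1) (q2 := q2)
    (c2 := c) (l := [::]) (r := d2 ++ r)) => //; pieces.
- by apply: flower0; [lk | par].
- by split=> //; par.
- by apply: link_nil.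
- by cov C.
- by mems.
Qed.

Lemma flower_step n : escapes G ->
  (forall m, m < n -> flower_case m /\ ear_case m) -> flower_case n.
Proof.
move=> E IH t d q c r ld od F mr C vin en.
have [pq oq lc oc] := F.
(* The walk starts from the colour class of the cycle that misses [t]; the hook is the whole
   flower. *)
have [|||||||] := E (evens d) (t :: odds d) (q ++ c) r => //.
- exact/bimatch_sym/(bimatch_linkl ld).
- by apply: matchable_cat; [apply: (matchable_path pq)|apply: (matchable_link lc)].
- by cov C.
- by case: d od {ld C vin}.
- move=> [s [q' [c' [r' [/evens_split [d1 [d2 [? o1]]] F' mr' e]]]]]; subst d.
  rewrite -!cat_cons !catA in C; have {e}C' := covers_perm C e; have [l1 l2] := link_split ld.
  apply: (flower_flower l1 l2 o1 _ F F' mr'); first by par.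
  + by cov C'.
  + by mems.
- move=> [s [s' [q' [r' [[/evens_split [d1 [d2 [? o1]]] s'd ss lq oq'] [mr' e]]]]]]; subst d.
  rewrite -!cat_cons !catA in C; have {e}C' := covers_perm C e; have [l1 l2] := link_split ld.
  move: s'd; rewrite evens_cat // evens_cons mem_cat inE (negPf ss) /=.
  case/orP=> [/evens_split|/odds_split] [f1 [f2 [? of1]]]; subst.
  + have [l11 l12] := link_split l1.
    apply: (flower_ear (v := v) (s := s') (s' := s) (e1 := f1) (e2 := f2) (e3 := d2)
      (h := rev q') (r := r') F) => //;
      pieces.
    * by cov C'.
    * by mems.
  + have [l11 l12] := link_split l2.
    apply: (flower_ear (v := v) (s := s) (s' := s') (e1 := d1) (e2 := f1) (e3 := f2)
      (h := q') (r := r') F) => //;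
      pieces.
    * by cov C'.
    * by mems.
- move=> [s [z [q' [r' [[/evens_split [d1 [d2 [? o1]]] zh lq oq'] [mr' e]]]]]]; subst d.
  rewrite -!cat_cons !catA in C; have {e}C' := covers_perm C e; have [l1 l2] := link_split ld.
  have o2: ~~ odd (size d2) by par.
  have [v1|v1] := boolP (v \in t :: s :: d1).
    apply: (flower_hit IH l1 l2 o1 o2 F lq oq' zh mr' _ v1 en).
    by cov C'.
  apply: (flower_hit IH (link_rev l2) (link_rev l1) _ _ F lq oq' zh mr' _ _ en); rewrite ?size_rev //.
  + by cov C'.
  + by mems.
Qed.

(** The new path [q] and the part [h2] of the hook connect [s] to [t2], leaving [h1] as a shorter
    ear. *)
Lemma ear_hit n t1 t2 e1 s e2 d h q z r :
  (forall m, m < n -> ear_case m /\ theta_case m) ->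
  link t1 e1 s -> link s e2 t2 -> link t1 d t2 -> link t1 h t2 ->
  ~~ odd (size e1) -> ~~ odd (size e2) -> odd (size d) -> ~~ odd (size h) ->
  z \in h -> link s q z -> ~~ odd (size q) -> matchable r ->
  covers (t1 :: t2 :: s :: e1 ++ e2 ++ d ++ h ++ q ++ r) ->
  v \in t1 :: t2 :: s :: e1 ++ e2 ++ d -> size h = n -> good v.
Proof.
move=> IH l1 l2 ld lh o1 o2 od oh zh lq oq mr C vin en.
(* Since [h] has an even number of inner vertices, [z] is at odd distance along [h] from exactly one
   end; call that end [t1]. *)
wlog oz: t1 t2 e1 e2 d h l1 l2 ld lh o1 o2 od oh zh C vin en /
    exists h1 h2, h = h1 ++ z :: h2 /\ ~~ odd (size h1).
  move=> W; case/splitPr: zh lh oh C en => h1 h2 lh oh C en.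
  have [oh1|oh1] := boolP (odd (size h1)); last first.
    apply: (W t1 t2 e1 e2 d (h1 ++ z :: h2)) => //; first by rewrite mem_cat inE eqxx orbT.
    by exists h1, h2.
  apply: (W t2 t1 (rev e2) (rev e1) (rev d) (rev (h1 ++ z :: h2))); rewrite ?size_rev //; try exact: link_rev.
  + by rewrite mem_rev mem_cat inE eqxx orbT.
  + by cov C.
  + by mems.
  + exists (rev h2), (rev h1); rewrite !size_rev rev_cat rev_cons cat_rcons; split=> //.
    by par.
case: oz => h1 [h2 [? oh1]]; subst h; have [lh1 lh2] := link_split lh.
have [|E T] := IH (size h1); first by par.
(* If [e2] is needed for [v], it serves as the third path between [s] and [t2]; otherwise it is
   discarded and an even cycle with ear [h1] remains. *)
have [v2|v2] := boolP (v \in [:: s, t2 & e2]).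
  apply: (T s t2 t1 z (rev e1) d q h2 e2 h1 r) => //; pieces.
  by cov C.
apply: (E t1 z (e1 ++ s :: q) (d ++ t2 :: rev h2) h1 (e2 ++ r)) => //; pieces.
- by cov C.
- by mems.
Qed.

Lemma ear_step n : escapes G ->
  (forall m, m < n -> ear_case m /\ theta_case m) -> ear_case n.
Proof.
move=> E IH t1 t2 d1 d2 h r l1 l2 lh o1 o2 oh mr C vin en.
(* Each arc has an odd number of inner vertices, so [d1] is matched together with [t1] and [d2]
   together with [t2]. *)
have [|||||||] := E (evens d1 ++ evens d2) ((t1 :: odds d1) ++ rcons (odds d2) t2) h r => //.
- apply: bimatch_cat; last exact: (bimatch_linkr l2).
  exact/bimatch_sym/(bimatch_linkl l1).
- exact: (matchable_link lh).
- by cov C.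
- by case: d1 o1 {l1 C vin}.
- move=> [s [q [c [r' [sd F mr' e]]]]].
  rewrite -!cat_cons !catA in C; have {e}C' := covers_perm C e.
  apply: (cycle_ear_flower (v := v) l1 l2 lh o1 o2 oh sd F mr') => //.
  by cov C'.
- move=> [s [s' [q [r' [[sd s'd ss lq oq] [mr' e]]]]]].
  rewrite -!cat_cons !catA in C; have {e}C' := covers_perm C e.
  apply: (cycle_ear_ear (v := v) l1 l2 lh o1 o2 oh sd s'd ss lq oq mr') => //.
  by cov C'.
- move=> [s [z [q [r' [[sd zh lq oq] [mr' e]]]]]].
  rewrite -!cat_cons !catA in C; have {e}C' := covers_perm C e.
  move: sd; rewrite mem_cat => /orP[]/evens_split [e1 [e2 [? oe]]]; subst.
    have [l11 l12] := link_split l1.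
    apply: (ear_hit (n := size h) (h := h) IH l11 l12 l2 lh oe _ o2 oh zh lq oq mr') => //.
    + by par.
    + by cov C'.
    + by mems.
  have [l21 l22] := link_split l2.
  apply: (ear_hit (n := size h) (h := h) IH l21 l22 l1 lh oe _ o1 oh zh lq oq mr') => //.
  + by par.
  + by cov C'.
  + by mems.
Qed.

(** The ears [h] and [q] join the same two paths. If they do not cross, they close one odd cycle at
    [s] and one at [t], and [g] joins these into a barbell; if they cross, an odd K4 using [g]
    results. Both keep [v]. *)
Lemma theta_ears s t x z a b e f g h y1 y2 q r :
  link s a x -> link x b t -> link s e z -> link z f t -> link s g t -> link x h z ->
  ~~ odd (size a) -> odd (size b) -> ~~ odd (size e) -> odd (size f) ->
  ~~ odd (size g) -> ~~ odd (size h) ->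
  y1 \in odds a ++ evens b -> y2 \in odds e ++ evens f ->
  link y1 q y2 -> ~~ odd (size q) -> matchable r ->
  covers (s :: t :: x :: z :: a ++ b ++ e ++ f ++ g ++ h ++ q ++ r) ->
  v \in s :: t :: g -> good v.
Proof.
move=> la lb le lf lg lh oa ob oe of' og oh; rewrite !mem_cat.
case/orP=> [/odds_split|/evens_split] [a1 [a2 [? oa1]]];
case/orP=> [/odds_split|/evens_split] [e1 [e2 [? oe1]]] lq oq mr C vin; subst.
- have [la1 la2] := link_split la; have [le1 le2] := link_split le.
  apply: (mk_barbell (v := v) (t := s) (s := t) (q1 := [::]) (c1 := a1 ++ y1 :: q ++ y2 :: rev e1)
    (q2 := [::]) (c2 := rev b ++ x :: h ++ z :: f) (l := g) (r := a2 ++ e2 ++ r)) => //;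
    pieces.
  + by apply: flower0; [lk | par].
  + by apply: flower0; [lk | par].
  + by cov C.
  + by mems.
- have [la1 la2] := link_split la; have [lf1 lf2] := link_split lf.
  apply: (mk_K4 (v := v) (a := s) (b := z) (c := y2) (d := t) (ab := e) (cd := e2)
    (ac := a1 ++ y1 :: q) (da := rev g) (bc := e1) (db := rev b ++ x :: h) (r := a2 ++ r)) => //;
    pieces.
  + by cov C.
  + by mems.
- have [lb1 lb2] := link_split lb; have [le1 le2] := link_split le.
  apply: (mk_K4 (v := v) (a := s) (b := x) (c := y1) (d := t) (ab := a) (cd := a2)
    (ac := e1 ++ y2 :: rev q) (da := rev g) (bc := a1) (db := rev f ++ z :: rev h) (r := e2 ++ r)) => //;
    pieces.
  + by cov C.
  + by mems.
have [lb1 lb2] := link_split lb; have [lf1 lf2] := link_split lf.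
apply: (mk_barbell (v := v) (t := s) (s := t) (q1 := [::]) (c1 := a ++ x :: h ++ z :: rev e)
    (q2 := [::]) (c2 := rev a2 ++ y1 :: q ++ y2 :: e2) (l := g) (r := a1 ++ e1 ++ r)) => //;
    pieces.
+ by apply: flower0; [lk | par].
+ by apply: flower0; [lk | par].
+ by cov C.
+ by mems.
Qed.

(** The route through [q] to [u] replaces part of the configuration and the part [h2] of the hook
    beyond [u] is the new ear; the position of [y] decides which path is discarded. *)
Lemma theta_hit n s t x z a b e f g h y u q r :
  (forall m, m < n -> ear_case m /\ theta_case m) ->
  link s a x -> link x b t -> link s e z -> link z f t -> link s g t -> link x h z ->
  ~~ odd (size a) -> odd (size b) -> ~~ odd (size e) -> odd (size f) ->
  ~~ odd (size g) -> ~~ odd (size h) ->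
  y \in s :: odds g ++ odds a ++ evens b ++ odds e ++ evens f -> u \in h ->
  link y q u -> ~~ odd (size q) -> matchable r ->
  covers (s :: t :: x :: z :: a ++ b ++ e ++ f ++ g ++ h ++ q ++ r) ->
  v \in s :: t :: g -> size h = n -> good v.
Proof.
move=> IH la lb le lf lg lh oa ob oe of' og oh yin uh lq oq mr C vin en.
(* Exchanging the paths through [x] and [z] puts [u] at even distance from [x] along [h], so [u] has
   the colour of [x]. *)
wlog ou: x z a b e f h la lb le lf lh oa ob oe of' oh yin uh C en /
    exists h1 h2, h = h1 ++ u :: h2 /\ odd (size h1).
  move=> W; case/splitPr: uh lh oh C en => h1 h2 lh oh C en.
  have [oh1|oh1] := boolP (odd (size h1)).
    apply: (W x z a b e f (h1 ++ u :: h2)) => //; first by rewrite mem_cat inE eqxx orbT.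
    by exists h1, h2.
  apply: (W z x e f a b (rev (h1 ++ u :: h2))); rewrite ?size_rev //; try exact: link_rev.
  + by mems.
  + by rewrite mem_rev mem_cat inE eqxx orbT.
  + by cov C.
  + exists (rev h2), (rev h1); rewrite !size_rev rev_cat rev_cons cat_rcons; split=> //.
    by par.
case: ou => h1 [h2 [? oh1]]; subst h; have [lh1 lh2] := link_split lh.
have [|E T] := IH (size h2); first by par.
move: yin; rewrite inE !mem_cat => /orP[/eqP ?|/or4P[|||/orP[]]].
- subst y.
  apply: (T s t u z q (rev h1 ++ x :: b) e f g h2 (a ++ r)) => //; pieces.
  by cov C.
- move=> /odds_split [g1 [g2 [? og1]]]; subst g; have [lg1 lg2] := link_split lg.
  (* If [v] is on the part of [g] from [y] to [t], then [y] takes over the role of [s]; otherwise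
     [g2] is discarded and an even cycle with an ear remains. *)
  have [v2|v2] := boolP (v \in y :: t :: g2).
    apply: (T y t u z q (rev h1 ++ x :: b) (rev g1 ++ s :: e) f g2 h2 (a ++ r)) => //; pieces.
    by cov C.
  apply: (E z u (f ++ t :: rev b ++ x :: h1) (rev e ++ s :: g1 ++ y :: q) (rev h2) (a ++ g2 ++ r));
    rewrite ?size_rev //; pieces.
  + by cov C.
  + by mems.
- move=> /odds_split [a1 [a2 [? oa1]]]; subst a; have [la1 la2] := link_split la.
  apply: (T s t u z (a1 ++ y :: q) (rev h1 ++ x :: b) e f g h2 (a2 ++ r)) => //; pieces.
  by cov C.
- move=> /evens_split [b1 [b2 [? ob1]]]; subst b; have [lb1 lb2] := link_split lb.
  apply: (T s t u z (a ++ x :: h1) (rev q ++ y :: b2) e f g h2 (b1 ++ r)) => //; pieces.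
  by cov C.
- move=> /odds_split [e1 [e2 [? oe1]]]; subst e; have [le1 le2] := link_split le.
  apply: (T y t u z q (rev h1 ++ x :: b) e2 f (rev e1 ++ s :: g) h2 (a ++ r)) => //; pieces.
  + by cov C.
  + by mems.
- move=> /evens_split [f1 [f2 [? of1]]]; subst f; have [lf1 lf2] := link_split lf.
  apply: (E z u (f1 ++ y :: q) (rev e ++ s :: g ++ t :: rev b ++ x :: h1) (rev h2) (a ++ f2 ++ r));
    rewrite ?size_rev //; pieces.
  + by cov C.
  + by mems.
Qed.

End Cases.

Section Cases.
Variables (G : sgraph) (v : G).
Implicit Types (x y s t u w z : G) (l q c d h r : seq G).

(** Discarding [e] leaves the even cycle through [a], [b], [g], with an odd ear from [x] to [t]
    along [h] and [f]; [y] is in the class opposite to [x] and [t]. *)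
Lemma theta_flower s t x z a b e f g h y q c r :
  link s a x -> link x b t -> link s e z -> link z f t -> link s g t -> link x h z ->
  ~~ odd (size a) -> odd (size b) -> ~~ odd (size e) -> odd (size f) ->
  ~~ odd (size g) -> ~~ odd (size h) ->
  y \in s :: odds g ++ odds a ++ evens b -> flower y q c -> matchable r ->
  covers (s :: t :: x :: z :: a ++ b ++ e ++ f ++ g ++ h ++ q ++ c ++ r) ->
  v \in s :: t :: g -> good v.
Proof.
move=> la lb le lf lg lh oa ob oe of' og oh yin F mr C vin.
apply: (cycle_ear_flower (v := v) (t1 := x) (t2 := t) (d1 := b) (d2 := rev a ++ s :: g)
  (h := h ++ z :: f) (y := y) (q := q) (c := c) (r := e ++ r)) => //;
  pieces.
- by rewrite evens_cat ?size_rev // evens_rev evens_cons (negPf oa); mems.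
- by cov C.
- by mems.
Qed.

Lemma theta_ear s t x z a b e f g h y1 y2 q r :
  link s a x -> link x b t -> link s e z -> link z f t -> link s g t -> link x h z ->
  ~~ odd (size a) -> odd (size b) -> ~~ odd (size e) -> odd (size f) ->
  ~~ odd (size g) -> ~~ odd (size h) ->
  y1 \in s :: odds g ++ odds a ++ evens b -> y2 \in s :: odds g ++ odds a ++ evens b ->
  y2 != y1 -> link y1 q y2 -> ~~ odd (size q) -> matchable r ->
  covers (s :: t :: x :: z :: a ++ b ++ e ++ f ++ g ++ h ++ q ++ r) ->
  v \in s :: t :: g -> good v.
Proof.
move=> la lb le lf lg lh oa ob oe of' og oh y1in y2in neq lq oq mr C vin.
apply: (cycle_ear_ear (v := v) (t1 := x) (t2 := t) (d1 := b) (d2 := rev a ++ s :: g)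
  (h := h ++ z :: f) (s := y1) (s' := y2) (q := q) (r := e ++ r)) => //;
  pieces.
- by rewrite evens_cat ?size_rev // evens_rev evens_cons (negPf oa); clear y2in; mems.
- by rewrite evens_cat ?size_rev // evens_rev evens_cons (negPf oa); clear y1in; mems.
- by cov C.
- by mems.
Qed.

Lemma theta_step n : escapes G ->
  (forall m, m < n -> ear_case v m /\ theta_case v m) -> theta_case v n.
Proof.
move=> E IH s t x z a b e f g h r la lb le lf lg lh oa ob oe of' og oh mr C vin en.
(* The walk leaves the colour class of [s]. The third path is matched with both its ends, [b] with
   [x] and [f] with [z]. *)
have [|||||||] := E ((s :: odds g) ++ odds a ++ evens b ++ odds e ++ evens f)
  (rcons (evens g) t ++ evens a ++ (x :: odds b) ++ evens e ++ (z :: odds f)) h r => //.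
- apply: bimatch_cat.
    have := bimatch_path lg; rewrite size_rcons oddS => /(_ og).
    by rewrite -!cats1 odds_cat // evens_cat // cats0.
  apply: bimatch_cat; first exact/bimatch_sym/(bimatch_link la).
  apply: bimatch_cat; first exact/bimatch_sym/(bimatch_linkl lb).
  apply: bimatch_cat; first exact/bimatch_sym/(bimatch_link le).
  exact/bimatch_sym/(bimatch_linkl lf).
- exact: (matchable_link lh).
- by cov C.
- move=> [y [q [c [r' [yin F mr' p]]]]].
  rewrite -!cat_cons !catA in C; have {p}C' := covers_perm C p.
  have [y1|y1] := boolP (y \in s :: odds g ++ odds a ++ evens b).
    apply: (theta_flower la lb le lf lg lh oa ob oe of' og oh y1 F mr' _ vin).
    by cov C'.
  apply: (theta_flower le lf la lb lg (link_rev lh) oe of' oa ob og _ _ F mr' _ vin).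
  + by par.
  + by clear vin; mems.
  + by cov C'.
- move=> [y1 [y2 [q [r' [[y1in y2in neq lq oq] [mr' p]]]]]].
  rewrite -!cat_cons !catA in C; have {p}C' := covers_perm C p.
  (* If both ends lie on the cycle of [g] with one of the other paths, [theta_ear] applies;
     otherwise the ear joins inner vertices of these two paths, as in [theta_ears]. *)
  have [y1A|y1A] := boolP (y1 \in s :: odds g ++ odds a ++ evens b);
  have [y2A|y2A] := boolP (y2 \in s :: odds g ++ odds a ++ evens b).
  + apply: (theta_ear la lb le lf lg lh oa ob oe of' og oh y1A y2A neq lq oq mr' _ vin).
    by cov C'.
  + have y2B : y2 \in odds e ++ evens f by clear vin y1in y1A; mems.
    have [y1B|y1B] := boolP (y1 \in s :: odds g ++ odds e ++ evens f).
      apply: (theta_ear le lf la lb lg (link_rev lh) oe of' oa ob og _ y1B _ neq lq oq mr' _ vin).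
      * by par.
      * by clear vin y1in y1A y1B; mems.
      * by cov C'.
    apply: (theta_ears la lb le lf lg lh oa ob oe of' og oh _ y2B lq oq mr' _ vin).
      by clear vin y2A y2B y2in; mems.
    by cov C'.
  + have y1B : y1 \in odds e ++ evens f by clear vin y2in y2A; mems.
    have [y2B|y2B] := boolP (y2 \in s :: odds g ++ odds e ++ evens f).
      apply: (theta_ear le lf la lb lg (link_rev lh) oe of' oa ob og _ _ y2B neq lq oq mr' _ vin).
      * by par.
      * by clear vin y2in y2A y2B; mems.
      * by cov C'.
    apply: (theta_ears la lb le lf lg lh oa ob oe of' og oh _ y1B (link_rev lq) _ mr' _ vin).
    * by clear vin y1A y1B y1in; mems.
    * by par.
    * by cov C'.
  apply: (theta_ear le lf la lb lg (link_rev lh) oe of' oa ob og _ _ _ neq lq oq mr' _ vin).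
  + by par.
  + by clear vin y2in y2A; mems.
  + by clear vin y1in y1A; mems.
  + by cov C'.
- move=> [y [u [q [r' [[yin uh lq oq] [mr' p]]]]]].
  rewrite -!cat_cons !catA in C; have {p}C' := covers_perm C p.
  apply: (theta_hit IH la lb le lf lg lh oa ob oe of' og oh yin uh lq oq mr' _ vin en).
  by cov C'.
Qed.

(** The three cases are proved together because each one descends to others with a smaller hook. *)
Lemma all_cases n : escapes G -> [/\ flower_case v n, ear_case v n & theta_case v n].
Proof.
move=> E; have [m] := ubnP n; elim: m n => // m IH n lnm.
have IH' k : k < n -> [/\ flower_case v k, ear_case v k & theta_case v k].
  by move=> lkn; apply: IH; lia.
split.
- by apply: flower_step => // k /IH' [].
- by apply: ear_step => // k /IH' [].
- by apply: theta_step => // k /IH' [].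
Qed.

Lemma escapes_good w r : escapes G -> adj v w -> matchable r -> covers (v :: w :: r) -> good v.
Proof.
move=> E vw mr C.
(* With an empty hook and a single starting vertex only a flower can occur; the edge traversed back
   and forth is its even cycle. *)
have [|||||||] := E [:: v] [:: w] [::] r => //.
- by exists [:: (v, w)]; rewrite /= vw.
- exact: matchable0.
- move=> [s [q [c [r' [/[!inE] /eqP-> F mr' p]]]]].
  have [FC _ _] := all_cases (size q + size c) E.
  rewrite -[v :: w :: r]/([:: v; w] ++ r) in C; have C' := covers_perm C p.
  apply: (FC v [:: w] q c r') => //; last by rewrite inE eqxx.
  by rewrite /link /= vw adj_sym vw.
- by move=> [s [s' [q [r' [[/[!inE] /eqP-> /eqP-> /[!eqxx]]]]]]].
- by move=> [s [z [q [r' [[_ /[!in_nil]]]]]]].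
Qed.
End Cases.

(** * Alternating reachability *)

Ltac counts :=
  clear; repeat match goal with |- context [count ?a ?b] => move: (count a b) => ? end; lia.
Section Pairing.
Variable G : sgraph.
Implicit Types (x y s t u w z v : G) (l q c d h r : seq G).

Definition pairing (m : G -> G) := involutive m /\ forall x, adj x (m x).

(* The state [a] stands for traversing the matching edge from [a] to [m a]. *)
Definition state_rel (m : G -> G) : rel G := fun a b => adj (m a) b.

Definition avoidable v :=
  [exists s : {perm G}, (s v == v) && [forall u, (u != v) ==> adj u (s u)]].

(** Composing with the involution [m] turns a permutation that fixes [v] into one whose orbit of [v]
    contains [m v], and conversely. *)
Lemma avoidable_connect m v : pairing m ->
  avoidable v = connect (state_rel m) v (m v).
Proof.
move=> [mK am]; apply/existsP/idP.
  move=> [s /andP[/eqP sv /forallP sa]].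
  (* Here [tau (m v) = v], and [y = tau x] means [s y = m x], so [m x] is adjacent to [y] unless [y]
     is [v]. *)
  pose tau x := (s^-1)%g (m x).
  have tau_inj : injective tau by move=> x y /perm_inj /(can_inj mK).
  have : fconnect tau v (m v).
    rewrite fconnect_sym // -[X in fconnect tau _ X](_ : tau (m v) = v) ?fconnect1 //.
    by rewrite /tau mK -[in LHS]sv permK.
  case/connectP=> p0 /shortenP[p pp /andP[vp _] _] ->.
  apply/connectP; exists p => //; elim: p {1 3}v pp vp {p0} => //= y p IH x /andP[/eqP xy pp].
  rewrite inE negb_or => /andP[vy vp]; apply/andP; split; last exact: IH.
  have := implyP (sa y); rewrite eq_sym => /(_ vy).
  by rewrite -xy /tau permKV adj_sym.
case/connectP=> p0 /shortenP[p pp up _] lastp.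
(* The cyclic predecessor of [v] is the last state [m v], hence [v] is fixed; a vertex off the list
   is its own predecessor and goes to its mate. *)
have f_inj : injective (fun x => m (prev (v :: p) x)).
  by apply: inj_comp; [exact: can_inj mK | exact: can_inj (next_prev up)].
have fv : prev (v :: p) v = m v.
  rewrite prev_nth mem_head (_ : index v p = size p) ?nth_last //.
  by apply/eqP; rewrite eqn_leq index_size leqNgt index_mem; case/andP: up.
exists (perm f_inj); rewrite permE fv mK eqxx; apply/forallP=> u; apply/implyP=> uv.
rewrite permE; have [uin|uout] := boolP (u \in v :: p); last first.
  by rewrite prev_nth (negPf uout) am.
(* Admitting every arc into [v] makes [v :: p] a cycle, while at other vertices the relation is
   still [state_rel]. *)
pose e a b := (b == v) || state_rel m a b.
have ce : cycle e (v :: p).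
  rewrite /= rcons_path {2}/e eqxx andbT; apply: sub_path pp => a b ab.
  by rewrite /e ab orbT.
by have := prev_cycle ce uin; rewrite /e (negPf uv) /= /state_rel adj_sym.
Qed.

Fixpoint mate (ps : seq (G * G)) x :=
  if ps is (a, b) :: ps' then
    if x == a then b else if x == b then a else mate ps' x
  else x.

Lemma mate_spec ps p : uniq (unzip1 ps ++ unzip2 ps) -> p \in ps ->
  mate ps p.1 = p.2 /\ mate ps p.2 = p.1.
Proof.
elim: ps => //= -[a b] ps IH; rewrite cat_uniq /= !mem_cat !inE !negb_or /= => /and3P[].
move=> /andP[a1 /andP[ab a2]] u1 /and3P[/andP[ba nh] b2 u2].
have {}nh : ~~ has (in_mem^~ (mem (unzip1 ps))) (unzip2 ps).
  by apply: contra nh => /hasP[x x2 x1]; apply/hasP; exists x => //=; rewrite inE x1 orbT.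
move=> /orP[/eqP->/=|pin]; first by rewrite !eqxx eq_sym (negPf ab).
have p1 : p.1 \in unzip1 ps by apply: map_f.
have p2 : p.2 \in unzip2 ps by apply: map_f.
have u : uniq (unzip1 ps ++ unzip2 ps) by rewrite cat_uniq u1 nh u2.
have [-> ->] := IH u pin.
have n1 : p.1 != a by apply: contraNneq a1 => <-.
have n2 : p.2 != a by apply: contraNneq a2 => <-.
have n3 : p.2 != b by apply: contraNneq b2 => <-.
have n4 : p.1 != b by apply: contraNneq ba => <-.
by rewrite (negPf n1) (negPf n2) (negPf n3) (negPf n4).
Qed.

Lemma covers_uniq l : covers l -> uniq l.
Proof.
move=> C; apply: count_mem_uniq => x; rewrite C.
by rewrite (_ : x \in l) // -has_pred1 has_count C.
Qed.

Lemma covers_mem l x : covers l -> x \in l.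
Proof. by move=> C; rewrite -has_pred1 has_count C. Qed.

Lemma mate_pairing ps : all (fun p => adj p.1 p.2) ps ->
  covers (unzip1 ps ++ unzip2 ps) -> pairing (mate ps).
Proof.
move=> al C.
have spec x : exists2 p, p \in ps & x = p.1 \/ x = p.2.
  by have := covers_mem x C; rewrite mem_cat => /orP[] /mapP[p pin ->]; exists p; auto.
have ms p := mate_spec (p := p) (covers_uniq C).
split=> x; have [p pin [->|->]] := spec x; have [e1 e2] := ms p pin; rewrite ?e1 ?e2 //.
  exact: (allP al).
by rewrite adj_sym; apply: (allP al).
Qed.

Lemma closed_matchable m l : pairing m -> uniq l -> {in l, forall x, m x \in l} -> matchable l.
Proof.
move=> [mK am]; have [n] := ubnP (size l); elim: n l => // n IH [|x l] sl.
  by move=> _ _; apply: matchable0.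
move=> /= /andP[xl ul] cl.
have mxx : m x != x by apply: contraTneq (am x) => ->; rewrite adj_irrefl.
have mxl : m x \in l by have := cl x (mem_head _ _); rewrite inE (negPf mxx).
have [||y yin|ps [al pe]] := IH (rem (m x) l).
- by rewrite size_rem //; move: sl mxl; case: (l) => //= *; lia.
- exact: rem_uniq.
- move: yin; rewrite !mem_rem_uniq // !inE => /andP[ymx yl].
  rewrite (can2_eq mK mK) mK; have := cl y; rewrite !inE yl orbT => /(_ isT).
  rewrite (can2_eq mK mK) (negPf ymx) /= => ->; rewrite andbT.
  by apply: contraNneq xl => <-.
exists ((x, m x) :: ps); rewrite /= am al; split=> //; rewrite perm_cons.
apply: (perm_trans (perm_to_rem mxl)); rewrite perm_sym -cat_rcons -cats1 -catA perm_catCA /=.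
by rewrite perm_cons perm_sym.
Qed.

Section Expand.
Variable m : G -> G.
Hypothesis pm : pairing m.

(** Turns a path of states into the alternating path of vertices that it stands for. *)
Definition expand (w : seq G) := flatten [seq [:: x; m x] | x <- w].

Lemma expand_cat (w1 w2 : seq G) : expand (w1 ++ w2) = expand w1 ++ expand w2.
Proof. by rewrite /expand map_cat flatten_cat. Qed.

Lemma size_expand (w : seq G) : size (expand w) = (size w).*2.
Proof. by elim: w => //= x w ->; lia. Qed.

Lemma mem_expand x (w : seq G) : (x \in expand w) = (x \in w) || (m x \in w).
Proof.
have [mK _] := pm; elim: w => //= y w IH; rewrite !inE IH (can2_eq mK mK).
by case: (x == y); case: (x == m y); rewrite ?orbT.
Qed.

Lemma path_expand b (w : seq G) : path (state_rel m) b w -> path (@adj G) (m b) (expand w).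
Proof. by have [_ am] := pm; elim: w b => //= x w IH b /andP[bx /IH pw]; apply/and3P; split. Qed.

Lemma last_expand b (w : seq G) : last (m b) (expand w) = m (last b w).
Proof. by elim: w b => //=. Qed.

Lemma uniq_expand (w : seq G) : uniq w -> {in w, forall a, m a \notin w} -> uniq (expand w).
Proof.
have [mK am] := pm; elim: w => //= x w IH /andP[xw uw] nw.
have nx := nw x (mem_head _ _); rewrite inE negb_or in nx; case/andP: nx => nx1 nx2.
rewrite inE negb_or eq_sym nx1 /= !mem_expand negb_or xw nx2 mK (negPf xw) (negPf nx2) /=.
apply: IH => // a aw; have := nw a; rewrite !inE aw orbT negb_or => /(_ isT) /andP[] //.
Qed.

End Expand.

Lemma last_exit (e : rel G) (A : pred G) b p : path e b p -> uniq (b :: p) -> A b ->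
  exists b' p', [/\ A b', path e b' p', uniq (b' :: p'), last b' p' = last b p & all (predC A) p'].
Proof.
have [n] := ubnP (size p); elim: n b p => // n IH b p sp pp up Ab.
have [/hasP[x xp Ax]|nA] := boolP (has A p); last by exists b, p; rewrite all_predC.
case/splitPr: xp sp pp up => p1 p2 sp; rewrite cat_path => /andP[_ /andP[_ pp]].
rewrite -cat_cons cat_uniq => /and3P[_ _ up]; rewrite last_cat /=.
by apply: IH => //; move: sp; rewrite size_cat /=; lia.
Qed.

(** The given matchings combine into one involution [m]. For [s0] in [b0], avoidability of [m s0]
    yields a path of states from [m s0] back to [s0], and its first event after leaving the
    bipartite part is one of the alternatives. *)
Lemma avoidable_escapes : (forall v, avoidable v) -> escapes G.
Proof.
move=> av b0 b1 h r [pb [kb e0 e1]] [ph [kh eh]] [pr [kr er]] C n0.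
pose ps := pb ++ ph ++ pr; pose m := mate ps.
have perm_ps : forall a, count a (unzip1 ps ++ unzip2 ps) = count a (b0 ++ b1 ++ h ++ r).
  move=> a; rewrite /unzip1 /unzip2 !map_cat !count_cat (permP e0) (permP e1) (permP eh) (permP er).
  by rewrite /unzip1 /unzip2 !count_cat addnACA [X in _ + X = _]addnACA [RHS]addnA.
have Cps : covers (unzip1 ps ++ unzip2 ps) by move=> x; rewrite perm_ps.
have pm : pairing m by apply: mate_pairing => //; rewrite !all_cat kb kh kr.
have [mK am] := pm.
have ms p : p \in ps -> m p.1 = p.2 /\ m p.2 = p.1 by apply: mate_spec (covers_uniq Cps).
have m0 x : x \in b0 -> m x \in b1.
  rewrite (perm_mem e0) (perm_mem e1) => /mapP[p pin ->].
  have [|-> _] := ms p; first by rewrite !mem_cat pin.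
  exact: map_f.
have mr x : x \in r -> m x \in r.
  rewrite !(perm_mem er) !mem_cat => /orP[] /mapP[p pin ->];
  (have [|e e'] := ms p; first by rewrite !mem_cat pin ?orbT); rewrite ?e ?e' map_f ?orbT //.
have cnt x := C x; have cmem x l : (x \in l) = (0 < count_mem x l) by rewrite -has_count has_pred1.
have mem4 x : [|| x \in b0, x \in b1, x \in h | x \in r].
  by have := covers_mem x C; rewrite !mem_cat.
have disj x l1 l2 l3 :
    (forall a : pred G, count a (b0 ++ b1 ++ h ++ r) =
                        count a l1 + count a l2 + count a l3) ->
    x \in l1 -> x \notin l2.
  move=> /(_ (pred1 x)); rewrite C !cmem.
  by case: (count _ l1) => // i; case: (count _ l2) => // j; rewrite addSn addnS.
have d01 x : x \in b0 -> x \notin b1 by apply: (disj x _ _ (h ++ r)) => a; rewrite !count_cat !addnA.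
have dr1 x : x \in r -> x \notin b1 by apply: (disj x _ _ (h ++ b0)) => a; rewrite !count_cat; counts.
have dr0 x : x \in r -> x \notin b0 by apply: (disj x _ _ (h ++ b1)) => a; rewrite !count_cat; counts.
have ur : uniq r by move: (covers_uniq C); rewrite !cat_uniq => /and3P[_ _ /and3P[_ _ /and3P[]]].
have [s0 s0b] : exists x, x \in b0 by case: (b0) n0 => // x l _; exists x; rewrite mem_head.
have : connect (state_rel m) (m s0) s0 by rewrite -{2}(mK s0) -avoidable_connect.
case/connectP=> p1 /shortenP[p2 pp2 up2 _] lastp.
(* After the last state in [b1] the walk leaves from [m b] in [b0], and its next return to the
   bipartite part can only be in [b0]. *)
have [b [p [bb pp up]]] := last_exit (A := mem b1) pp2 up2 (m0 _ s0b).
rewrite -lastp => lastbp np; have {lastp pp2 up2 p1 p2} lb : last b p \in b0 by rewrite lastbp.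
have {}bb : b \in b1 := bb.
have sb : m b \in b0.
  move: bb; rewrite (perm_mem e0) (perm_mem e1) => /mapP[p3 pin ->].
  have [|_ ->] := ms p3; first by rewrite !mem_cat pin.
  exact: map_f.
(* [w] is the part already walked, inside [r] and using each matching edge once; [p'] lies ahead. *)
suff H (w p' : seq G) : path (state_rel m) b (w ++ p') -> uniq (w ++ p') -> {subset w <= r} ->
  all (predC (mem b1)) p' -> last b (w ++ p') \in b0 -> {in w, forall a, m a \notin w} ->
  [\/ exists s q c r', [/\ s \in b0, flower s q c, matchable r' & perm_eq r (q ++ c ++ r')],
      exists s s' q r', [/\ s \in b0, s' \in b0, s' != s, link s q s' & ~~ odd (size q)] /\
         matchable r' /\ perm_eq r (q ++ r')
    | exists s z q r', [/\ s \in b0, z \in h, link s q z & ~~ odd (size q)] /\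
         matchable r' /\ perm_eq r (q ++ r')].
  by apply: (H [::] p) => //; case/andP: up.
elim: p' w {p pp up lastbp np lb} => [|y p' IH] w.
  rewrite cats0 => _ _ wr _ lb _; case/lastP: w wr lb => [|w x] wr /=.
    by move=> /d01; rewrite bb.
  by rewrite last_rcons (negPf (dr0 x _)) // wr // mem_rcons mem_head.
move=> pwp; have := pwp; rewrite cat_path /= => /and3P[pw ey _] uw wr /andP[/= ny np'] lb reg.
have uw' : uniq w by move: uw; rewrite cat_uniq => /and3P[].
have eu := uniq_expand pm uw' reg.
have er' x : x \in expand m w -> x \in r.
  by rewrite (mem_expand pm) => /orP[/wr//|/wr/mr]; rewrite mK.
pose r' := [seq x <- r | x \notin expand m w].
have pr' : perm_eq r (expand m w ++ r').
  apply: uniq_perm => //.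
    rewrite cat_uniq eu filter_uniq // andbT; apply/hasPn=> x.
    by rewrite mem_filter => /andP[].
  move=> x; rewrite mem_cat mem_filter; case: (boolP (x \in expand m w)) => [/er'->|_] //.
have mr' : matchable r'.
  apply: (closed_matchable pm); first exact: filter_uniq.
  move=> x; rewrite !mem_filter => /andP[nx /mr ->]; rewrite andbT.
  by apply: contra nx; rewrite !(mem_expand pm) mK orbC.
have pe := path_expand pm pw.
have pl z : adj (m (last b w)) z -> link (m b) (expand m w) z.
  by move=> az; rewrite /link rcons_path pe last_expand.
have oe (w' : seq G) : ~~ odd (size (expand m w')) by rewrite size_expand odd_double.
case/or4P: (mem4 y) => [y0|y1|yh|yr].
(* A return to the starting point [m b] is a flower with empty stem; a return elsewhere in [b0] is
   an ear. *)
- have [eys|neys] := eqVneq y (m b).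
    constructor 1; exists (m b), [::], (expand m w), r'; split=> //.
    by split=> //; rewrite [last _ _]/=; apply: pl; rewrite -[X in adj _ X]eys.
  by constructor 2; exists (m b), y, (expand m w), r'; split=> //; split=> //; apply: pl.
- by rewrite y1 in ny.
- by constructor 3; exists (m b), y, (expand m w), r'; split=> //; split=> //; apply: pl.
(* The walk meets one of its matching edges from the other end: the stem stops with that edge and an
   odd cycle closes at [y]. *)
have [myw|myw] := boolP (m y \in w).
  clearbody r'; constructor 1; case/splitPr: myw (pl y ey) pr' => w1 w2 ly pr'.
  exists (m b), (expand m (rcons w1 (m y))), (expand m w2), r'; split=> //;
    last by rewrite catA -expand_cat cat_rcons.
  move: ly; rewrite -cat_rcons expand_cat /link rcons_cat cat_path => /andP[p1 p2].
  by move: p2; rewrite last_expand last_rcons mK => p2; split=> //; rewrite last_expand last_rcons mK.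
have yw : y \notin w.
  by move: uw; rewrite cat_uniq => /and3P[_ /hasPn/(_ y (mem_head _ _))].
apply: (IH (rcons w y)); rewrite ?cat_rcons //.
  by move=> x; rewrite mem_rcons inE => /orP[/eqP->|/wr].
have myy : m y != y by apply: contraTneq (am y) => ->; rewrite adj_irrefl.
move=> a; rewrite !mem_rcons !inE => /orP[/eqP->|aw]; rewrite negb_or; first by rewrite myy.
rewrite reg // andbT; apply: contraNneq myw => <-; by rewrite mK.
Qed.

End Pairing.

(** * Sachs subgraphs and perfect matchings *)

Lemma eq_set2 (T : finType) (x y a b : T) :
  ([set x; y] == [set a; b]) = (x == a) && (y == b) || (x == b) && (y == a).
Proof.
apply/eqP/orP=> [e|[/andP[/eqP-> /eqP->]//|/andP[/eqP-> /eqP->]]]; last by rewrite setUC.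
have := set21 a b; have := set22 a b; rewrite -e => /set2P hb /set2P ha.
have := set21 x y; have := set22 x y; rewrite e => /set2P hy /set2P hx.
by case: hx hy ha hb => -> [] -> [] E1 [] E2; rewrite ?E1 ?E2 ?eqxx; auto.
Qed.

Section Sachs.
Variable H : sgraph.
Implicit Types x y : H.

Lemma edgesE x y : ([set x; y] \in edges H) = adj x y.
Proof.
apply/imset2P/idP=> [[a b _]|xy]; last by exists x y; rewrite ?inE.
rewrite inE => /andP[_ ab] /eqP; rewrite eq_set2.
by case/orP=> /andP[/eqP-> /eqP->] //; rewrite adj_sym.
Qed.

(** Each component is shifted by one step along a cyclic order, a K2 being read as a cyclic list of
    two vertices. *)
Lemma sachs_shift (F : {set {set H}}) : sachs_subgraph F ->
  exists2 f : H -> H, injective f & forall x, adj x (f x).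
Proof.
move=> [Fe comp].
pose P x (c : seq H) := [&& uniq c, cycle (@adj H) c & component F x == [set u in c]].
have exP x : exists c, P x c.
  case: (comp x) => [[u [w [uw cx ex]]]|[c [/and3P[_ uc cc] cx _]]].
    have uwF : [set u; w] \in F.
      have : [set u; w] \in component_edges F x by rewrite ex inE.
      by rewrite inE => /andP[].
    have uwa : adj u w by rewrite -edgesE (subsetP Fe).
    exists [:: u; w]; rewrite /P /= inE uw uwa adj_sym uwa cx /=.
    by apply/eqP/setP=> z; rewrite !inE.
  by exists c; rewrite /P uc cc cx eqxx.
pose c x := xchoose (exP x).
have cP x : P x (c x) := xchooseP (exP x).
have memc x y : (y \in c x) = (y \in component F x).
  by have /and3P[_ _ /eqP->] := cP x; rewrite inE.
have Fsym : connect_sym [rel u w | [set u; w] \in F].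
  by apply: sym_connect_sym => u w /=; rewrite setUC.
(* The choice depends only on the component, so all its vertices receive the same cyclic list. *)
have csame x y : y \in c x -> c y = c x.
  rewrite memc inE => xy; apply: eq_xchoose => d; rewrite /P.
  suff -> : component F y = component F x by [].
  by apply/setP=> z; rewrite !inE (same_connect Fsym xy).
have xc x : x \in c x by rewrite memc inE connect0.
exists (fun x => next (c x) x) => [x y e|x].
  have exy : c x = c y.
    by rewrite -(csame x (next (c x) x)) ?mem_next // e (csame y) ?mem_next.
  have /and3P[uc _ _] := cP x.
  by apply: (can_inj (prev_next uc)); rewrite e exy.
by have /and3P[_ cc _] := cP x; apply: next_cycle.
Qed.

(** The components are the orbits of [f]: those of size two are K2, longer ones are cycles, and
    irreflexivity excludes size one. *)
Lemma shift_sachs (f : H -> H) : injective f -> (forall x, adj x (f x)) ->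
  exists F : {set {set H}}, sachs_subgraph F.
Proof.
move=> fI fa; pose F : {set {set H}} := [set [set x; f x] | x in [set: H]].
have FE x y : ([set x; y] \in F) = (y == f x) || (x == f y).
  apply/imsetP/orP=> [[z _ /eqP]|].
    by rewrite eq_set2 => /orP[]/andP[/eqP-> /eqP->]; rewrite eqxx; auto.
  by case=> /eqP->; [exists x | exists y] => //; rewrite setUC.
have compE x : component F x = [set y in orbit f x].
  apply/setP=> y; rewrite !inE -fconnect_orbit.
  apply/idP/idP; last first.
    by apply: connect_sub => a b /eqP <-; apply: connect1; rewrite /= FE eqxx.
  apply: connect_sub => a b /=; rewrite FE => /orP[]/eqP->; first exact: fconnect1.
  by rewrite fconnect_sym // fconnect1.
have fne x : f x != x by apply: contraTneq (fa x) => ->; rewrite adj_irrefl.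
have ceE x : component_edges F x = [set [set y; f y] | y in orbit f x].
  apply/setP=> e; rewrite inE compE; apply/andP/imsetP.
    case=> /imsetP[y _ ->] /subsetP/(_ y); rewrite !inE eqxx => /(_ isT) yx.
    by exists y.
  case=> y yx ->; split; first by apply: imset_f.
  apply/subsetP=> z; rewrite !inE => /orP[]/eqP-> //.
  by rewrite -fconnect_orbit; apply: connect_trans (fconnect1 f y); rewrite fconnect_orbit.
exists F; split.
  by apply/subsetP=> e /imsetP[x _ ->]; rewrite edgesE.
move=> x; have ox := order_gt0 f x.
have sz : size (orbit f x) = order f x := size_orbit f x.
have nx : forall y, y \in orbit f x -> next (orbit f x) y = f y.
  move=> y yx; apply/esym/eqP; exact: (next_cycle (cycle_orbit fI x) yx).
have [o2|o2] := ltnP 2 (order f x).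
  right; exists (orbit f x); split=> //; last first.
    by rewrite ceE; apply: eq_in_imset => y /nx ->.
  rewrite /is_cycle sz o2 orbit_uniq /=.
  by apply: sub_cycle (cycle_orbit fI x) => a b /eqP <-.
have oE : order f x = 2.
  move: o2 ox; case E: (order f x) => [|[|[|k]]] // _ _.
  have := iter_order fI x; rewrite E /= => e; by have := fne x; rewrite e eqxx.
have oL : orbit f x = [:: x; f x] by rewrite /orbit oE.
left; exists x, (f x); rewrite compE ceE oL; split=> //.
- by rewrite eq_sym.
- by apply/setP=> y; rewrite !inE.
have ffx : f (f x) = x by have := iter_order fI x; rewrite oE.
apply/setP=> e; apply/imsetP/set1P=> [[y]|->]; last by exists x; rewrite ?inE ?eqxx.
by rewrite !inE => /orP[]/eqP-> ->; rewrite // ffx setUC.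
Qed.

End Sachs.

(** * Sachs subgraphs after deleting one vertex *)

Section Deletion.
Variable G : sgraph.
Implicit Types v x y : G.

Lemma avoidable_sachs v :
  avoidable v <-> exists F : {set {set del_vertices [set v]}}, sachs_subgraph F.
Proof.
split=> [/existsP[s /andP[/eqP sv /forallP sa]]|[F /sachs_shift[f fI fa]]].
  have sP (x : del_vertices [set v]) : s (val x) \notin [set v].
    by rewrite inE -[X in _ == X]sv (inj_eq perm_inj); have := valP x; rewrite inE.
  pose f (x : del_vertices [set v]) : del_vertices [set v] := Sub (s (val x)) (sP x).
  apply: (@shift_sachs (del_vertices [set v]) f) => [x y|x].
    by move/(congr1 val) => /= /perm_inj /val_inj.
  by have := implyP (sa (val x)); apply; have := valP x; rewrite inE.
pose g x := if insub x is Some y then val (f y) else x.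
have gv : g v = v by rewrite /g insubN // inE eqxx.
have gN x : x != v -> exists2 y : del_vertices [set v], val y = x & g x = val (f y).
  move=> xv; have xS : x \notin [set v] by rewrite inE.
  by exists (Sub x xS); rewrite // /g (insubT (fun x => x \notin [set v]) xS).
have gnv x : x != v -> g x != v.
  by case/gN=> y _ ->; have := valP (f y); rewrite inE.
have gI : injective g.
  move=> x y; have [->|xv] := eqVneq x v; have [->|yv] := eqVneq y v => //.
  - by rewrite gv => e; have := gnv y yv; rewrite -e eqxx.
  - by rewrite gv => e; have := gnv x xv; rewrite e eqxx.
  have [a <- ->] := gN x xv; have [b <- ->] := gN y yv.
  by move=> /val_inj /fI ->.
apply/existsP; exists (perm gI); rewrite permE gv eqxx; apply/forallP=> u; apply/implyP=> uv.
by rewrite permE; have [y <- ->] := gN u uv; apply: fa.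
Qed.

Lemma sachs_critical1 : sachs_critical 1 G <-> forall v, avoidable v.
Proof.
split=> [sc v|av S /eqP/cards1P[v ->]]; last exact/avoidable_sachs.
by apply/avoidable_sachs; apply: sc; rewrite cards1.
Qed.

End Deletion.

(** * Perfect matchings as adjacency-respecting involutions *)

Section Matchings.
Variable G : sgraph.
Implicit Types (x y v : G) (M : {set {set G}}).

Lemma matching_card M : matching M -> #|cover M| = 2 * #|M|.
Proof.
move=> /andP[/subsetP Me /eqP <-]; rewrite mulnC -sum_nat_const.
apply: eq_bigr => f /Me /imset2P[x y _]; rewrite inE => /andP[_ xy] ->.
by rewrite cards2; case: eqVneq xy => // ->; rewrite adj_irrefl.
Qed.

Lemma perfect_maximum M : perfect_matching M -> maximum_matching M.
Proof.
move=> /andP[mM /forallP sat]; split=> // M' mM'.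
have cT : cover M = [set: G] by apply/setP=> x; rewrite inE; apply: sat.
have := matching_card mM; have := matching_card mM'; rewrite cT.
by have := subset_leq_card (subsetT (cover M')); lia.
Qed.

Lemma maximum_perfect M0 M : perfect_matching M0 -> maximum_matching M -> perfect_matching M.
Proof.
move=> /andP[mM0 /forallP sat] [mM maxM]; rewrite /perfect_matching mM; apply/forallP=> v.
have cT : cover M0 = [set: G] by apply/setP=> x; rewrite inE; apply: sat.
suff cM : cover M = [set: G] by rewrite /saturated cM inE.
apply/eqP; rewrite eqEcard subsetT -cT (matching_card mM) (matching_card mM0).
by rewrite leq_mul2l maxM.
Qed.

Lemma perfect_pairing M : perfect_matching M ->
  exists2 m : G -> G, pairing m & forall x y, ([set x; y] \in M) = (y == m x).
Proof.
move=> /andP[/andP[/subsetP Me /trivIsetP tM] /forallP sat].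
have adjM x y : [set x; y] \in M -> adj x y by move/Me; rewrite edgesE.
have ex x : exists y, [set x; y] \in M.
  have /bigcupP[f fM xf] := sat x; have := Me f fM => /imset2P[a b _ _ ef].
  move: xf; rewrite ef !inE => /orP[]/eqP->; [exists b | exists a]; by rewrite ?[[set b; a]]setUC -ef.
have un x y z : [set x; y] \in M -> [set x; z] \in M -> y = z.
  move=> yM zM; apply/eqP; case: (eqVneq [set x; y] [set x; z]) => [/eqP|ne].
    rewrite eq_set2 eqxx /= => /orP[//|/andP[/eqP <- /eqP ->]//].
  have := tM _ _ yM zM ne; rewrite -setI_eq0 => /eqP/setP/(_ x); by rewrite !inE eqxx.
pose m x := xchoose (ex x); have mP x : [set x; m x] \in M := xchooseP (ex x).
have mE x y : ([set x; y] \in M) = (y == m x).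
  by apply/idP/eqP=> [yM|->//]; apply: un yM (mP x).
exists m => //; split=> x; last exact: adjM.
by apply/esym/eqP; rewrite -mE setUC.
Qed.

Definition pair_edges (m : G -> G) : {set {set G}} := [set [set x; m x] | x in [set: G]].

Lemma pair_edgesE m x y : pairing m -> ([set x; y] \in pair_edges m) = (y == m x).
Proof.
move=> [mK _]; apply/imsetP/eqP=> [[z _ /eqP]|->]; last by exists x.
by rewrite eq_set2 => /orP[]/andP[/eqP-> /eqP->]; rewrite ?mK.
Qed.

Lemma pair_edges_perfect m : pairing m -> perfect_matching (pair_edges m).
Proof.
move=> pm; have [mK am] := pm; rewrite /perfect_matching /matching -andbA; apply/and3P; split.
- by apply/subsetP=> e /imsetP[x _ ->]; rewrite edgesE.
- apply/trivIsetP=> e f /imsetP[x _ ->] /imsetP[y _ ->].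
  apply: contraR; rewrite -setI_eq0 => /set0Pn[z]; rewrite !inE eq_set2.
  case/andP=> /orP[]/eqP-> /orP[]; rewrite ?(can2_eq mK mK) ?(inj_eq (can_inj mK)) ?mK => /eqP->;
  by rewrite ?mK !eqxx ?orbT.
apply/forallP=> v; apply/bigcupP; exists [set v; m v]; first exact: imset_f.
by rewrite !inE eqxx.
Qed.

End Matchings.

(** * Blossoms and Tposies *)

Fixpoint mated (T : eqType) (m : T -> T) (l : seq T) :=
  if l is a :: l' then
    if l' is b :: l'' then (b == m a) && mated m l'' else false
  else true.

Lemma mated_nth (T : eqType) (m : T -> T) x l : ~~ odd (size l) ->
  (forall j, j.*2.+1 < size l -> nth x l j.*2.+1 = m (nth x l j.*2)) -> mated m l.
Proof.
have [n] := ubnP (size l); elim: n l => // n IH [|a [|b l]] //= ltn.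
rewrite negbK => el H; have /= -> := H 0 isT; rewrite eqxx /=; apply: IH => // [|j lj]; first by lia.
by have := H j.+1; rewrite doubleS /=; apply.
Qed.

Lemma mated_split (T : eqType) (m : T -> T) l x : mated m l -> x \in l ->
  exists l1 a l2, l = l1 ++ a :: m a :: l2 /\ (x = a \/ x = m a).
Proof.
have [n] := ubnP (size l); elim: n l => // n IH [|a [|b l]] //= ltn.
case/andP=> /eqP-> ml; rewrite !inE => /or3P[/eqP->|/eqP->|xl].
- by exists [::], a, l; split=> //; left.
- by exists [::], a, l; split=> //; right.
have [|l1 [c [l2 [-> h]]]] := IH l _ ml xl; first by lia.
by exists [:: a, m a & l1], c, l2.
Qed.

(** * Edge sets of walks and cycles *)

Section Walks.
Variable G : sgraph.
Implicit Types (x y u v a b : G) (l p c : seq G) (M : {set {set G}}).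

Lemma next_split b l l1 u v l2 : uniq (b :: l) -> rcons (b :: l) b = l1 ++ u :: v :: l2 ->
  u \in b :: l /\ next (b :: l) u = v.
Proof.
move=> ul e.
have nthE i : nth b (b :: l) i = nth b (l1 ++ u :: v :: l2) i by rewrite -e nth_rcons_default.
have lt1 : size l1 < size (b :: l).
  by have := congr1 size e; rewrite size_rcons size_cat /=; lia.
have eu : u = nth b (b :: l) (size l1) by rewrite nthE nth_cat ltnn subnn.
have ev : v = nth b (b :: l) (size l1).+1 by rewrite nthE nth_cat ltnNge leqnSn /= subSnn.
have ui : u \in b :: l by rewrite eu mem_nth.
by split=> //; rewrite next_nth ui {1}eu index_uniq // ev.
Qed.

Lemma walk_edges_cat x l1 l2 :
  walk_edges x (l1 ++ l2) = walk_edges x l1 ++ walk_edges (last x l1) l2.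
Proof. exact: pairmap_cat. Qed.

Lemma mem_walk_edges x p (f : {set G}) :
  f \in walk_edges x p -> exists u v, [/\ f = [set u; v], u \in belast x p & v \in p].
Proof.
elim: p x => //= y p IH x; rewrite inE => /orP[/eqP->|/IH[u [v [-> ui vi]]]].
  by exists x, y; rewrite !inE !eqxx.
by exists u, v; rewrite !inE ui vi !orbT.
Qed.

Lemma walk_edges_split x p (f : {set G}) :
  f \in walk_edges x p <-> exists l1 u v l2, x :: p = l1 ++ u :: v :: l2 /\ f = [set u; v].
Proof.
split.
  elim: p x => //= y p IH x; rewrite inE => /orP[/eqP->|/IH[l1 [u [v [l2 [-> ->]]]]]].
    by exists [::], x, y, p.
  by exists (x :: l1), u, v, l2.
case=> l1 [u [v [l2 [e ->]]]]; elim: l1 x p e => [|y l1 IH] x p /= [-> e].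
  by rewrite e /= mem_head.
by case: l1 IH e => [|z l1] IH -> /=; rewrite inE (IH _ _ erefl) orbT.
Qed.

Lemma cycle_edges_walk b l : uniq (b :: l) ->
  cycle_edges (b :: l) =i walk_edges b (rcons l b).
Proof.
move=> ul f; apply/imsetP/idP=> [[u uin ->]|/walk_edges_split[l1 [u [v [l2 [e ->]]]]]].
  apply/walk_edges_split.
  have [p1 [p2 e]] : exists p1 p2, b :: l = p1 ++ u :: p2.
    by case/splitPr: uin => p1 p2; exists p1, p2.
  case: p2 e => [|v p2] e.
    have e' : rcons (b :: l) b = p1 ++ [:: u; b] by rewrite e -cats1 -catA.
    by have [_ ->] := next_split ul e'; exists p1, u, b, [::].
  have e' : rcons (b :: l) b = p1 ++ [:: u, v & rcons p2 b] by rewrite e -!cats1 -catA.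
  by have [_ ->] := next_split ul e'; exists p1, u, v, (rcons p2 b).
by have [ui nu] := next_split ul e; exists u; rewrite ?nu.
Qed.

End Walks.

(** * Strong connectivity of the states around a Tposy *)

Section PosyConnected.
Variables (G : sgraph) (M : {set {set G}}) (m : G -> G).
Implicit Types (x y u v w a b : G) (l p c : seq G).
Hypothesis matM : matching M.
Hypothesis pm : pairing m.
Hypothesis mE : forall x y, ([set x; y] \in M) = (y == m x).

Lemma matching_edge (f : {set G}) u : f \in M -> u \in f -> f = [set u; m u].
Proof.
move=> fM; have /imset2P[a b _ _ ef] : f \in edges G by case/andP: matM => /subsetP/(_ f fM).
rewrite ef in fM *; rewrite !inE => /orP[]/eqP->.
  by move: fM; rewrite mE => /eqP->.
by move: fM; rewrite setUC mE => /eqP->.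
Qed.

(** By counting, the matching edges of the blossom cover every vertex but the base. Mates are
    therefore neighbours on the cycle, and starting after [b] the pairing is forced. *)
Lemma blossom_mated c b : blossom M c b ->
  exists l, [/\ uniq (b :: l), link b l b, l != [::], c =i b :: l & mated m l].
Proof.
have [mK am] := pm; case/and5P=> /and3P[sc uc cc] oc /eqP cE bc bE.
have [i l rl] := rot_to bc.
have ul : uniq (b :: l) by rewrite -rl rot_uniq.
have cl : c =i b :: l by move=> u; rewrite -rl mem_rot.
have szl : size c = (size l).+1 by rewrite -(size_rot i) rl.
have lk : link b l b by rewrite -(rot_cycle i) rl in cc.
have ce : cycle_edges c = cycle_edges (b :: l).
  by rewrite /cycle_edges -rl; apply/setP=> f; apply/imsetP/imsetP=> -[u uin ->];
    exists u; rewrite ?next_rot // ?mem_rot // -(mem_rot i).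
rewrite {}ce in cE bE; set E := _ :&: M in cE bE.
have mE' : matching E.
  case/andP: matM => Me tM; rewrite /matching (subset_trans (subsetIr _ _) Me) /=.
  by apply: trivIsetS tM; apply: subsetIr.
have coverE : cover E = [set u in l].
  apply/eqP; rewrite eqEcard; apply/andP; split.
    apply/subsetP=> u uE; have : u \in b :: l.
      case/bigcupP: uE => f; rewrite inE => /andP[/imsetP[w wl ->] _].
      by rewrite in_set2 => /orP[]/eqP->; rewrite ?mem_next.
    by rewrite !inE => /orP[/eqP eu|//]; rewrite -eu uE in bE.
  rewrite (matching_card mE') cE cardsE szl (card_uniqP _); last by case/andP: ul.
  by move: oc; rewrite szl /=; clear; lia.
have lE u : u \in l -> [set u; m u] \in E.
  have -> : (u \in l) = (u \in cover E) by rewrite coverE inE.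
  case/bigcupP=> f fE uf; have fM : f \in M by move: fE; rewrite inE => /andP[].
  by rewrite -(matching_edge fM uf).
have mb u : u \in l -> m u != b.
  move=> /lE uE; apply: contra bE => /eqP e.
  by apply/bigcupP; exists [set u; m u]; rewrite // !inE e eqxx orbT.
exists l; split=> //; first by case: (l) szl => // e; rewrite e in sc.
have nxt j : j <= size l -> next (b :: l) (nth b (b :: l) j) = nth b l j.
  by move=> lj; rewrite next_nth mem_nth // index_uniq.
have alt u : u \in l -> m u = next (b :: l) u \/ u = next (b :: l) (m u).
  move/lE; rewrite inE => /andP[/imsetP[w _ e] _]; move/eqP: e; rewrite eq_set2.
  by case/orP=> /andP[/eqP-> /eqP->]; [left | right].
have el : ~~ odd (size l) by move: oc; rewrite szl.
(* The mate is the successor or the predecessor, and the predecessor is either the base or already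
   paired. *)
apply: (mated_nth (x := b)) => //; elim=> [|j IH] lj.
  have al : nth b l 0 \in l by apply: mem_nth; apply: leq_ltn_trans lj.
  have na : next (b :: l) (nth b l 0) = nth b l 1 by rewrite -(nxt 1) // ltnW.
  case: (alt _ al) => [->//|e]; exfalso.
  have /= e0 := nxt 0 isT; rewrite {1}e in e0.
  by have /esym/eqP := can_inj (prev_next ul) e0; rewrite (negPf (mb _ al)).
rewrite doubleS in lj *; have {}IH := IH (ltnW (ltnW lj)).
set a := nth b l j.*2.+2; have al : a \in l by apply: mem_nth; apply: ltnW.
have na : next (b :: l) a = nth b l j.*2.+3 by rewrite -(nxt j.*2.+3) // ltnW.
case: (alt _ al) => [->//|e]; exfalso.
have := nxt j.*2.+2 (ltnW (ltnW lj)); rewrite /= -/a {1}e => e0.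
have := can_inj (prev_next ul) e0; rewrite /= IH => /(can_inj mK) /eqP.
by case/andP: ul => _ ul; rewrite /a nth_uniq //; move: lj; clear; lia.
Qed.

Lemma mm_path_mated x p : mm_path M x p -> path (@adj G) x p /\ mated m (x :: p).
Proof.
case/andP=> /andP[/andP[pp _] alt] mm; split=> //.
case: p alt mm {pp} => // a p alt /= /andP[xa la].
move: alt; rewrite /walk_edges /= -/walk_edges.
have [n] := ubnP (size p); elim: n p x a xa la => // n IH [|b [|c p]] x a xa la ltn //=.
- by rewrite mE in xa; rewrite xa.
- by rewrite /= in la; rewrite xa la.
rewrite xa; case/and3P=> abN bcM pp; rewrite mE in xa; rewrite xa /=.
have bc : [set b; c] \in M by move: abN bcM; case: (_ \in M).
by apply: IH => //=; move: ltn => /=; lia.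
Qed.

(** A walk read backwards traverses every matching edge in the opposite direction. *)
Lemma skew u v : connect (state_rel m) u v -> connect (state_rel m) (m v) (m u).
Proof.
have [mK am] := pm; case/connectP=> p; elim: p u => [|y p IH] u /=; first by move=> _ ->.
case/andP=> uy pp e; apply: connect_trans (IH _ pp e) _; apply: connect1.
by rewrite /state_rel mK adj_sym.
Qed.

(** The route uses each matching edge in one direction, so of a vertex and its mate only one need be
    a state on it. *)
Lemma mated_connect a l : path (@adj G) a l -> mated m (a :: l) ->
  connect (state_rel m) a (m (last a l)) /\
  forall u, u \in a :: l -> exists2 w, w = u \/ w = m u &
    connect (state_rel m) a w /\ connect (state_rel m) w (m (last a l)).
Proof.
have [mK am] := pm; have [n] := ubnP (size l); elim: n l a => // n IH [|b [|c l]] a //= ltn.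
  rewrite andbT => _ /andP[/eqP-> _]; rewrite mK; split=> // u.
  by rewrite !inE => /orP[]/eqP->; exists a; rewrite ?mK; auto.
case/and3P=> ab bc pl /andP[/eqP eb ml].
have ac : connect (state_rel m) a c by apply: connect1; rewrite /state_rel -eb.
have [|cl IHc] := IH l c _ pl ml; first by move: ltn; clear; lia.
have al := connect_trans ac cl.
split=> // u; rewrite inE => /orP[/eqP->|]; first by exists a; auto.
rewrite inE => /orP[/eqP->|/IHc[w wu [cw wl]]]; first by exists a; rewrite ?eb ?mK; auto.
by exists w => //; split=> //; apply: connect_trans cw.
Qed.

Lemma blossom_connect b l : link b l b -> l != [::] -> mated m l ->
  connect (state_rel m) (m b) b /\
  forall u, u \in l -> exists2 w, w = u \/ w = m u &
    connect (state_rel m) (m b) w /\ connect (state_rel m) w b.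
Proof.
have [mK am] := pm; case: l => // a l; rewrite /link /= rcons_path => /and3P[ba pl lb] _ ml.
have [al H] := mated_connect pl ml.
have ma : connect (state_rel m) (m b) a by apply: connect1; rewrite /state_rel mK.
have lm : connect (state_rel m) (m (last a l)) b by apply: connect1; rewrite /state_rel mK.
split=> [|u /H[w wu [aw wl]]]; first exact: connect_trans ma (connect_trans al lm).
by exists w => //; split; [apply: connect_trans ma aw | apply: connect_trans wl lm].
Qed.

(** With [y] the second base, the states run from [x] along the path to [m y], around [c2] to [y],
    back to [m x], and around [c1] to [x]. *)
Lemma tposy_connect c1 c2 x p v : tposy M c1 c2 x p ->
  [\/ v \in c1, v \in c2 | v \in x :: p] -> connect (state_rel m) v (m v).
Proof.
have [mK am] := pm; case=> -[/blossom_mated[l1 [_ k1 n1 e1 m1]] /blossom_mated[l2 [_ k2 n2 e2 m2]]].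
case/mm_path_mated=> pp mp _ _.
have [b1 H1] := blossom_connect k1 n1 m1; have [b2 H2] := blossom_connect k2 n2 m2.
have [xy Hp] := mated_connect pp mp; set y := last x p in e2 b2 H2 xy Hp.
have yx := skew xy; rewrite mK in yx.
have xmx := connect_trans xy (connect_trans b2 yx).
(* By [skew], a state strongly connected to [x] has its mate strongly connected to [m x], which lies
   in the same class. *)
have key w : connect (state_rel m) x w -> connect (state_rel m) w x ->
    connect (state_rel m) w (m w) /\ connect (state_rel m) (m w) w.
  move=> xw wx; have := skew xw; have := skew wx => mxw mwx; split.
    exact: connect_trans wx (connect_trans xmx mxw).
  exact: connect_trans mwx (connect_trans b1 xw).
have fin w : w = v \/ w = m v -> connect (state_rel m) x w -> connect (state_rel m) w x ->
    connect (state_rel m) v (m v).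
  by move=> [->|->] xw wx; have [] := key _ xw wx; rewrite ?mK.
have yxx := connect_trans yx b1.
case; rewrite ?e1 ?e2; last first.
- case/Hp=> w wv [xw wy]; apply: (fin w) => //.
  exact: connect_trans wy (connect_trans b2 yxx).
- rewrite inE => /orP[/eqP->|/H2[w wv [yw wy]]].
    by apply: (key y _ yxx).1; apply: connect_trans xy b2.
  by apply: (fin w) => //; [apply: connect_trans xy yw | apply: connect_trans wy yxx].
rewrite inE => /orP[/eqP->|/H1[w wv [xw wx]]] //.
by apply: (fin w) => //; apply: connect_trans xmx xw.
Qed.

End PosyConnected.

(** Every maximum matching is perfect here, so no stem can end at an unsaturated vertex and only
    Tposies remain. *)
Lemma SD_avoidable (G : sgraph) (M0 : {set {set G}}) (v : G) :
  perfect_matching M0 -> SD v -> avoidable v.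
Proof.
move=> p0 [M [maxM T]]; have pM := maximum_perfect p0 maxM.
have [m pm mE] := perfect_pairing pM; have [mM _] := maxM.
case: T => [[c [x [p [[_ _ _ /negP[]]]]]]|[c1 [c2 [x [p [T vT]]]]]].
  by case/andP: pM => _ /forallP.
by rewrite (avoidable_connect v pm); apply: (tposy_connect mM pm mE T vT).
Qed.

(** * Matchings built along prescribed paths *)

Fixpoint pairs (T : Type) (l : seq T) : seq (T * T) :=
  if l is a :: l' then if l' is b :: l'' then (a, b) :: pairs l'' else [::] else [::].

Lemma pairs_count (T : Type) (a : pred T) l : ~~ odd (size l) ->
  count a l = count a (unzip1 (pairs l)) + count a (unzip2 (pairs l)).
Proof.
have [n] := ubnP (size l); elim: n l => // n IH [|x [|y l]] //= ltn.
by rewrite negbK => el; rewrite IH //; [lia | move: ltn; clear; lia].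
Qed.

Lemma pairs_mated (T : eqType) (m : T -> T) l : ~~ odd (size l) ->
  {in pairs l, forall p, m p.1 = p.2} -> mated m l.
Proof.
have [n] := ubnP (size l); elim: n l => // n IH [|x [|y l]] //= ltn.
rewrite negbK => el H; have /= -> := H (x, y) (mem_head _ _); rewrite eqxx /=.
by apply: IH => // [|p pl]; [move: ltn; clear; lia | apply: H; rewrite inE pl orbT].
Qed.

Section Build.
Variable G : sgraph.
Implicit Types (x y u v w a b : G) (l c : seq G) (M : {set {set G}}).

Lemma pairs_adj x l : path (@adj G) x l -> all (fun p => adj p.1 p.2) (pairs (x :: l)).
Proof.
have [n] := ubnP (size l); elim: n l x => // n IH [|y [|z l]] //= x ltn.
by case/and3P=> -> yz pl; apply: IH => //; move: ltn; clear; lia.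
Qed.

(** Each path is matched in consecutive pairs and [r] as given, which yields the freedom to choose
    the matching that exhibits a Tposy. *)
Lemma mated_pairing (ls : seq (seq G)) r :
  all (fun l => sorted (@adj G) l && ~~ odd (size l)) ls -> matchable r ->
  covers (flatten ls ++ r) -> exists2 m, pairing m & all (mated m) ls.
Proof.
move=> als [pr [kr er]] C.
pose ps := flatten (map (@pairs G) ls) ++ pr.
have Cps : covers (unzip1 ps ++ unzip2 ps).
  move=> y; rewrite -(C y) /ps {C} /unzip1 /unzip2 !map_cat !count_cat (permP er) count_cat.
  rewrite /unzip1 /unzip2 addnACA; congr (_ + _).
  elim: ls als {ps} => //= l ls IH /andP[/andP[_ el] /IH{}IH].
  by rewrite !map_cat !count_cat addnACA IH (pairs_count _ el).
have ka : all (fun p : G * G => adj p.1 p.2) ps.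
  rewrite /ps all_cat kr andbT; elim: ls als {C ps Cps} => //= l ls IH /andP[/andP[sl _] /IH {}IH].
  by rewrite all_cat IH andbT; case: l sl => // x l; apply: pairs_adj.
exists (mate ps); first exact: mate_pairing.
apply/allP=> l lls; have /andP[_ el] := allP als l lls.
apply: pairs_mated => // p pin; apply: (proj1 (mate_spec (covers_uniq Cps) _)).
by rewrite mem_cat; apply/orP; left; apply/flattenP; exists (pairs l) => //; apply: map_f.
Qed.

Variable m : G -> G.
Hypothesis pm : pairing m.
Let M := pair_edges m.

Lemma mated_size l : mated m l -> ~~ odd (size l).
Proof.
have [n] := ubnP (size l); elim: n l => // n IH [|x [|y l]] //= ltn /andP[_ ml].
by rewrite negbK; apply: IH => //; move: ltn; clear; lia.
Qed.

Lemma mated_closed l x : mated m l -> x \in l -> m x \in l.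
Proof.
have [mK _] := pm; move=> ml /(mated_split ml)[l1 [a [l2 [-> [->|->]]]]];
by rewrite ?mK mem_cat !inE eqxx ?orbT.
Qed.

Lemma mated_cat l1 l2 : mated m l1 -> mated m l2 -> mated m (l1 ++ l2).
Proof.
have [n] := ubnP (size l1); elim: n l1 => // n IH [|x [|y l]] //= ltn /andP[-> ml] m2.
by apply: IH => //; move: ltn; clear; lia.
Qed.

Lemma walk_edges_cons x y p : walk_edges x (y :: p) = [set x; y] :: walk_edges y p.
Proof. by []. Qed.

Lemma mated_mm_path x p :
  path (@adj G) x p -> uniq (x :: p) -> mated m (x :: p) -> mm_path M x p.
Proof.
have [mK am] := pm; move=> pp up mp; rewrite /mm_path /alternating_path /is_path pp up.
case: p up mp {pp} => // a p up /andP[/eqP ea mp]; rewrite walk_edges_cons.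
suff H n q y d : size q < n -> d = m y -> uniq [:: y, d & q] -> mated m q ->
    path (fun f g => (f \in M) (+) (g \in M)) [set y; d] (walk_edges d q) /\
    last [set y; d] (walk_edges d q) \in M.
  have [/= -> ->] := H _ p x a (ltnSn _) ea up mp.
  by rewrite pair_edgesE // ea eqxx.
elim: n q y d {up mp ea} => // n IH [|b [|c q]] y d ltn ed // uq mq.
  by rewrite /= pair_edgesE // ed eqxx.
case/andP: mq => /eqP ec mq; rewrite !walk_edges_cons /= !pair_edgesE // ed ec !eqxx mK.
have yb : (b == y) = false.
  by apply: contraTF uq => /eqP->; rewrite /= !inE eqxx !orbT.
rewrite yb /= -ec; apply: IH => //; first by move: ltn => /=; clear; lia.
by case/and3P: uq.
Qed.

Lemma mated_blossom x l : link x l x -> uniq (x :: l) -> l != [::] -> mated m l ->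
  blossom M (x :: l) x.
Proof.
have [mK am] := pm; move=> lk ul nl ml.
have el := mated_size ml.
have sl : 1 < size l by case: (l) nl el => [|? []].
have /andP[mM _] := pair_edges_perfect pm.
set E := cycle_edges (x :: l) :&: M.
have xl : x \notin l by case/andP: ul.
(* The mate of the base is outside the cycle, since [l] is closed under [m]; so the matching edges
   of the cycle cover exactly [l], which gives their number. *)
have coverE : cover E = [set u in l].
  apply/setP=> u; rewrite inE; apply/bigcupP/idP=> [[f]|uin].
    rewrite inE => /andP[/imsetP[w wl ef] fM] uf.
    have fu := matching_edge mM (fun x y => pair_edgesE x y pm) fM uf.
    have inl z : z \in f -> z \in x :: l by rewrite ef in_set2 => /orP[]/eqP->; rewrite ?mem_next.
    have := inl u uf; rewrite inE => /orP[/eqP eu|//].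
    have mu : m u \in x :: l by apply: inl; rewrite fu !inE eqxx orbT.
    move: mu; rewrite inE eu; have -> : (m x == x) = false.
      by apply: contraTF (am x) => /eqP->; rewrite adj_irrefl.
    by move/(mated_closed ml); rewrite mK (negPf xl).
  exists [set u; m u]; last by rewrite !inE eqxx.
  rewrite inE pair_edgesE // eqxx andbT cycle_edges_walk //.
  have [l1 [a [l2 [el2 ua]]]] := mated_split ml uin.
  have -> : [set u; m u] = [set a; m a].
    by case: ua => ->; rewrite ?mK // setUC.
  apply/walk_edges_split; exists (x :: l1), a, (m a), (rcons l2 x); split=> //.
  by rewrite el2 rcons_cat.
have mE : matching E.
  case/andP: mM => Me tM; rewrite /matching (subset_trans (subsetIr _ _) Me) /=.
  by apply: trivIsetS tM; apply: subsetIr.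
apply/and5P; split; rewrite ?mem_head //.
- by rewrite /is_cycle ul /= ltnS sl.
- have := matching_card mE; rewrite coverE cardsE (card_uniqP _); last by case/andP: ul.
  rewrite -/E /= => e; apply/eqP; move: e el; clear; lia.
by rewrite coverE inE.
Qed.

End Build.

(** * Barbells and odd K4 subdivisions as Tposies *)

Section Realize.
Variable G : sgraph.
Implicit Types (x y u v w a b t s : G) (l c q r : seq G).

Lemma link_sorted u l w : link u l w -> sorted (@adj G) l.
Proof. by rewrite /link rcons_path => /andP[/path_sorted]. Qed.

Lemma covers_sub_uniq l l' : covers l -> (forall a : pred G, count a l' <= count a l) -> uniq l'.
Proof.
move=> C le; apply: count_mem_uniq => x; have := le (pred1 x); rewrite C.
by rewrite -has_pred1 has_count; case: (count_mem x l') => [|[]].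
Qed.

Lemma covers_disjoint l l1 l2 z : covers l ->
  (forall a : pred G, count a l1 + count a l2 <= count a l) -> z \in l1 -> z \notin l2.
Proof.
move=> C le; rewrite -!has_pred1 !has_count; have := le (pred1 z); rewrite C.
by case: (count_mem z l1) => // n; case: (count_mem z l2) => // k; rewrite addSn addnS.
Qed.

Lemma perfect_SD m M v : pairing m -> M = pair_edges m -> in_tposy M v -> SD v.
Proof.
move=> pm -> T; exists (pair_edges m); split; last by right.
exact: perfect_maximum (pair_edges_perfect pm).
Qed.

Ltac cle := move=> f; rewrite /= -?cats1 ?(count_cat, count_rev) /= ?(count_cat, count_rev) /=
   ?(count_cat, count_rev) /= ;
  repeat match goal with |- context [count ?a ?b] => move: (count a b) => ? end;
  repeat match goal with |- context [nat_of_bool ?b] => move: (nat_of_bool b) => ? end;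
  clear; lia.

(** Match each odd cycle without its base, and the whole path from base to base through both stems
    and [l] in consecutive pairs; this path begins and ends with matching edges. *)
Lemma barbell_SD v : barbell v -> SD v.
Proof.
case=> t [s [q1 [c1 [q2 [c2 [l [r [[[p1 o1 k1 oc1] [p2 o2 k2 oc2] lk ol]] [mr C vin]]]]]]]].
set x := last t q1; pose p := rev (belast t q1) ++ l ++ s :: q2.
have eP : x :: p = rev (t :: q1) ++ l ++ s :: q2 by rewrite /p (lastI t q1) rev_rcons.
have lxt : last x (rev (belast t q1)) = t.
  by rewrite /x; case: (q1) => //= y q; rewrite rev_cons last_rcons.
have pp : path (@adj G) x p.
  rewrite cat_path lxt (link_path lk p2) andbT /x rev_path.
  by rewrite (eq_path (e' := @adj G)) // => a b; rewrite adj_sym.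
have ly : last x p = last s q2 by rewrite /p last_cat lxt last_cat.
have np : p != [::] by rewrite /p; case: (rev _) => //; case: (l).
clearbody p; have C' : covers (x :: p ++ c1 ++ c2 ++ r) by rewrite -cat_cons eP; cov C.
set y := last s q2 in k2 ly.
have [|| m pm /and4P[mp m1 m2 _]] := mated_pairing (ls := [:: x :: p; c1; c2]) _ mr.
- rewrite /= pp (link_sorted k1) (link_sorted k2) oc1 oc2 !andbT.
  by rewrite -/(odd (size p).+1) -/(size (x :: p)) eP; par.
- by cov C'.
have lastp : forall a : pred G, count a (x :: p) = count a (belast x p) + a y.
  by move=> a; rewrite lastI ly -cats1 count_cat /= addn0.
have up : uniq (x :: p) by apply: covers_sub_uniq C' _; cle.
have u1 : uniq (x :: c1) by apply: covers_sub_uniq C' _; cle.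
have u2 : uniq (y :: c2).
  by apply: covers_sub_uniq C' _ => a; rewrite -cat_cons count_cat lastp; move: a; cle.
have yp : y \in p.
  by case: p np ly {pp eP C' mp up lastp} => // z p' _ /= <-; apply: mem_last.
have xp : x \notin p by case/andP: up.
have xy : x != y by apply: contraNneq xp => ->.
have d1 z : z \in c1 -> z \notin x :: p by apply: (covers_disjoint C'); cle.
have d2 z : z \in c2 -> z \notin x :: p by apply: (covers_disjoint C'); cle.
have d12 z : z \in c1 -> z \notin c2 by apply: (covers_disjoint C'); cle.
have ne c w : link w c w -> c != [::] by case: c => //; rewrite /link /= adj_irrefl.
apply: (perfect_SD pm erefl); exists (x :: c1), (y :: c2), x, p; split; last first.
  have : [|| v \in x :: p, v \in c1 | v \in c2] by rewrite eP; mems.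
  case/or3P=> vi; [constructor 3 | constructor 1 | constructor 2] => //;
  by rewrite inE vi orbT.
split.
- rewrite ly; split; apply: mated_blossom => //; exact: ne k1 || exact: ne k2.
- exact: mated_mm_path.
- rewrite ly => z zp zx zy; rewrite !inE (negPf zx) (negPf zy) /=.
  by split; apply: contraL zp; [apply: d1 | apply: d2].
left; apply/setP=> z; rewrite !inE; apply/negbTE; rewrite negb_and !negb_or.
have [->|zx] /= := eqVneq z x.
  by rewrite xy /=; apply: contraTN (mem_head x p); apply: d2.
have [->|zy] /= := eqVneq z y.
  by rewrite orbF; apply/negP=> /d1; rewrite inE yp orbT.
by rewrite -negb_and; apply/negP=> /andP[/d12/negP].
Qed.

(** Match the paths [ab] and [cd] with their ends and the other four without. The cycles through
    [a], [c], [d] and [b], [c], [d] are blossoms with bases [a] and [b]; they share the path from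
    [c] to [d] and are joined by the path from [a] to [b]. *)
Lemma odd_K4_SD v : odd_K4 v -> SD v.
Proof.
case=> a [b [c [d [ab [cd [ac [da [bc [db [r [[kab kcd kac kda [kbc kdb]]]]]]]]]]]]].
case=> -[oab ocd oac oda [obc odb]] [mr C vin].
pose q := c :: rcons cd d; pose p := rcons ab b.
have C' : covers (a :: p ++ q ++ ac ++ da ++ bc ++ db ++ r) by rewrite /p /q; cov C.
have [|| m pm /= ] := mated_pairing (ls := [:: a :: p; q; ac; da; bc; db]) _ mr.
- rewrite /= -[path _ a p]/(link a ab b) -[path _ c _]/(link c cd d) kab kcd.
  rewrite (link_sorted kac) (link_sorted kda) (link_sorted kbc) (link_sorted kdb).
  by rewrite !size_rcons /= !negbK oab ocd oac oda obc odb.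
- by cov C'.
case/and5P=> mp mq mac mda /and3P[mbc mdb _].
have k1 : link a (ac ++ q ++ da) a.
  by rewrite /q cat_cons cat_rcons; lk.
have k2 : link b (bc ++ q ++ db) b.
  by rewrite /q cat_cons cat_rcons; lk.
have C2 : covers (a :: b :: ab ++ q ++ ac ++ da ++ bc ++ db ++ r) by rewrite /q; cov C.
have u1 : uniq (a :: ac ++ q ++ da) by apply: covers_sub_uniq C2 _; cle.
have u2 : uniq (b :: bc ++ q ++ db) by apply: covers_sub_uniq C2 _; cle.
have up : uniq (a :: p) by rewrite /p; apply: covers_sub_uniq C2 _; cle.
have d1 z : z \in ab -> z \notin a :: ac ++ q ++ da by apply: (covers_disjoint C2); cle.
have d2 z : z \in ab -> z \notin b :: bc ++ q ++ db by apply: (covers_disjoint C2); cle.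
have d12 z : z \in a :: ac ++ da -> z \notin b :: bc ++ q ++ db by apply: (covers_disjoint C2); cle.
have ly : last a p = b by rewrite last_rcons.
(* An edge of the first blossom off the path from [c] to [d] has an end in [a :: ac ++ da], which
   the second blossom avoids; hence the common edges are those of that path. *)
have side w f : f \in cycle_edges (b :: bc ++ q ++ db) -> w \in f -> w \notin a :: ac ++ da.
  case/imsetP=> z zin -> wz; have wb : w \in b :: bc ++ q ++ db.
    by move: wz; rewrite in_set2 => /orP[]/eqP->; rewrite ?mem_next.
  by apply/negP=> /d12; rewrite wb.
have wq u l1 l2 : rcons (l1 ++ q ++ l2) u = rcons l1 c ++ rcons cd d ++ rcons l2 u.
  by rewrite /q !rcons_cat (cat_rcons c).
apply: (perfect_SD pm erefl).
exists (a :: ac ++ q ++ da), (b :: bc ++ q ++ db), a, p; split; last first.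
  rewrite /p /q; have : [|| v \in a :: ac ++ q ++ da, v \in b :: bc ++ q ++ db | v \in a :: p].
    by rewrite /p /q -!cats1; mems.
  by case/or3P=> vi; [constructor 1 | constructor 2 | constructor 3].
clear vin; have nq l1 l2 : l1 ++ q ++ l2 != [::] by case: l1.
split.
- by rewrite ly; split; apply: mated_blossom => //; rewrite ?mated_cat.
- exact: mated_mm_path.
- rewrite ly => z; rewrite inE mem_rcons inE => /or3P[->//|->//|zab] _ _.
  by rewrite (negPf (d1 z zab)) (negPf (d2 z zab)).
right; exists c, (rcons cd d); split.
- apply: mated_mm_path => //.
  by apply: covers_sub_uniq C' _; cle.
- apply/setP=> z; rewrite -/q in_setI !in_set.
  apply/andP/idP=> [[]|zq]; last by rewrite !in_cons !mem_cat zq !orbT.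
  move=> z1 z2; have : z \notin a :: ac ++ da by apply: contraL z2; apply: d12.
  by move: z1; rewrite /q; mems.
apply/setP=> f; rewrite inE inE; apply/andP/idP=> [[f1 f2]|fq].
  have := f1; rewrite cycle_edges_walk // wq !walk_edges_cat !mem_cat last_rcons.
  case/or3P=> [/mem_walk_edges[u [w [ef ui _]]]|//|/mem_walk_edges[u [w [ef _ wi]]]].
    have uf : u \in f by rewrite ef !inE eqxx.
    by move: (side u f f2 uf) ui; rewrite belast_rcons; clear f1 f2 uf; mems.
  have wf : w \in f by rewrite ef !inE eqxx orbT.
  by move: (side w f f2 wf) wi; rewrite mem_rcons; clear f1 f2 wf; mems.
by rewrite !cycle_edges_walk // !wq !walk_edges_cat !mem_cat !last_rcons fq !orbT.
Qed.

Lemma good_SD v : good v -> SD v.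
Proof. by case=> [/barbell_SD|/odd_K4_SD]. Qed.

End Realize.

Theorem theorem3p7 (G : sgraph)
    (hG : exists M : {set {set G}}, perfect_matching M) :
  sterboul_deming G <-> sachs_critical 1 G.
Proof.
have [M pM] := hG; split=> [sd|/sachs_critical1 av v].
  (* Since [avoidable] is boolean, the double negation of [SD v] in the hypothesis is enough. *)
  apply/sachs_critical1 => v; apply: contraT => nav; case: (sd v) => /(SD_avoidable pM).
  exact/negP.
have [m pm _] := perfect_pairing pM; have [mK am] := pm.
(* [r] consists of all vertices off the starting edge; it is closed under [m] and hence
   matchable. *)
apply; apply: good_SD; pose r := [seq x <- enum G | x \notin [:: v; m v]].
have rE x : (x \in r) = (x \notin [:: v; m v]) by rewrite mem_filter mem_enum andbT.
have vm : m v != v by apply: contraTneq (am v) => ->; rewrite adj_irrefl.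
apply: (@escapes_good _ _ (m v) r) => //; first exact: avoidable_escapes.
  apply: (closed_matchable pm) => [|x]; first exact/filter_uniq/enum_uniq.
  rewrite !rE; apply: contra; rewrite !inE.
  by rewrite !(can2_eq mK mK) mK orbC.
move=> x; rewrite count_uniq_mem; first by rewrite !inE rE !inE orbA orbN.
by rewrite /= !inE !rE !inE !eqxx orbT eq_sym (negPf vm) filter_uniq ?enum_uniq.
Qed.
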